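(* Let $X$ and $Y$ be the first-hop and second-hop SNRs of the selected relay (independent, with the distributions given in the context), let $\zeta\ge 1$ be a constant, let $\gamma=\frac{XY}{\zeta Y+X+\zeta}$ be the end-to-end SNDR of variable gain relaying (version II), with ergodic capacity $\overline{C}=\frac12\mathbb{E}[\log_2(1+\gamma)]$, and let $\gamma^{\rm ub}=\frac{XY}{X+\zeta Y}\ge\gamma$. Then $\overline{C}\le\overline{C}^{\rm ub}$, where $\overline{C}^{\rm ub}=\frac12\mathbb{E}[\log_2(1+\gamma^{\rm ub})]$ is given by $$\overline{C}^{\rm ub}=\frac{k^2\bar\gamma_1\binom{N}{k}^2}{4\log(2)}\sum_{m=0}^{k-1}\sum_{n=0}^{k-1}\sum_{i=1}^{2}\sum_{j=1}^{2}\frac{S_mP_nT_{m,i}Q_{n,j}}{(U_{m,i}+\zeta R_{n,j})^2}\sqrt{\frac{U_{m,i}\zeta}{R_{n,j}}}\;\mathcal{H}(\tau_1,\tau_2),\qquad \tau_1=\frac{\bar\gamma_1}{U_{m,i}+\zeta R_{n,j}},\quad \tau_2=\frac{\sqrt{\zeta U_{m,i}R_{n,j}}}{U_{m,i}+\zeta R_{n,j}},$$ where $\log$ is the natural logarithm and $\mathcal{H}(\tau_1,\tau_2)=H_{1,0:1,1:0,2}^{0,1:1,1:2,0}\left(\begin{smallmatrix}(-1;1,1)\\-\end{smallmatrix}\Big|\begin{smallmatrix}(0,1)\\(0,1)\end{smallmatrix}\Big|\begin{smallmatrix}-\\ (\frac12,\frac12),(-\frac12,\frac12)\end{smallmatrix}\Big|\tau_1,\tau_2\right)$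 is the bivariate Fox H-function defined in the context.
   Context: Integers $1\le k\le N$ ($N$ relays, the relay of rank $k$ is selected), average SNRs $\bar\gamma_1,\bar\gamma_2>0$, correlation coefficients $\rho_1,\rho_2\in[0,1]$, and $\bar\gamma=\bar\gamma_1\bar\gamma_2/(\bar\gamma_1+\bar\gamma_2)$. For $0\le n,m\le k-1$ set $$P_n=\frac{(-1)^n\binom{k-1}{n}}{1+\frac{\bar\gamma_2}{\bar\gamma}(N-k+n)},\qquad S_m=\frac{(-1)^m\binom{k-1}{m}}{1+\frac{\bar\gamma_1}{\bar\gamma}(N-k+m)},$$ $$Q_{n,1}=1,\quad Q_{n,2}=\frac{(N-k+n)\bar\gamma_2}{\rho_1\bar\gamma+(1-\rho_1)(N-k+n+1)\bar\gamma_1},\qquad R_{n,1}=1,\quad R_{n,2}=\frac{(N-k+n+1)\bar\gamma_1}{\rho_1\bar\gamma+(1-\rho_1)(N-k+n+1)\bar\gamma_1},$$ $$T_{m,1}=1,\quad T_{m,2}=\frac{(N-k+m)\bar\gamma_1}{(N-k+m+1)\bar\gamma_2},\qquad U_{m,1}=\frac{\bar\gamma_1}{\bar\gamma_2},\quad U_{m,2}=\frac{(N-k+m+1)\bar\gamma_1}{\rho_2\bar\gamma+(1-\rho_2)(N-k+m+1)\bar\gamma_2}.$$ $X$ and $Y$ are independent nonnegative random variables; $X$ has density, for $x\ge 0$, $$f_X(x)=\frac{k}{\bar\gamma_1}\binom{N}{k}\sum_{n=0}^{k-1}\sum_{j=1}^{2}P_nQ_{n,j}\exp\!\left(-\frac{R_{n,j}x}{\bar\gamma_1}\right),$$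 and $Y$ has CDF, for $x\ge 0$, $$F_Y(x)=1-k\binom{N}{k}\sum_{m=0}^{k-1}\sum_{i=1}^{2}S_mT_{m,i}\exp\!\left(-\frac{U_{m,i}x}{\bar\gamma_1}\right).$$ The bivariate Fox H-function with these parameters is the double Mellin–Barnes integral, for $\tau_1,\tau_2>0$, $$\mathcal{H}(\tau_1,\tau_2)=\frac{1}{(2\pi \mathrm{i})^2}\int_{\mathcal{L}_1}\int_{\mathcal{L}_2}\Gamma(2+s+t)\,\Gamma(-s)\Gamma(1+s)\,\Gamma\!\left(\tfrac12-\tfrac t2\right)\Gamma\!\left(-\tfrac12-\tfrac t2\right)\tau_1^{s}\tau_2^{t}\,dt\,ds,$$ where $\mathcal L_1,\mathcal L_2$ are upward vertical lines with $-1<\operatorname{Re}s<0$, $\operatorname{Re}t<-1$ and $\operatorname{Re}(s+t)>-2$ (for example $\operatorname{Re}s=-\tfrac14$, $\operatorname{Re}t=-\tfrac54$). *)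

(* Defs.v *)
From HB Require Import structures.
From mathcomp Require Export all_boot all_order all_algebra.
From mathcomp Require Export all_classical all_reals all_analysis.
From mathcomp Require Export complex.

Set Implicit Arguments.
Unset Strict Implicit.
Unset Printing Implicit Defensive.

Export Order.TTheory GRing.Theory Num.Theory.
Export numFieldNormedType.Exports.

Local Open Scope classical_set_scope.
Local Open Scope ring_scope.
Local Open Scope complex_scope.

(* N - k + n; it is only used for k <= N, where the truncated subtraction
   on nat is the ordinary one. *)
Definition rank_shift (R : realType) (N k n : nat) : R := (N - k + n)%:R.

Definition gbar (R : realType) (g1 g2 : R) : R := g1 * g2 / (g1 + g2).

(* The second index of coefQ, coefR, coefT and coefU is 1 or 2. *)
Definition coefP (R : realType) (N k : nat) (g1 g2 : R) (n : nat) : R :=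
  (-1) ^+ n * 'C(k - 1, n)%:R /
    (1 + g2 / gbar g1 g2 * rank_shift R N k n).

Definition coefS (R : realType) (N k : nat) (g1 g2 : R) (m : nat) : R :=
  (-1) ^+ m * 'C(k - 1, m)%:R /
    (1 + g1 / gbar g1 g2 * rank_shift R N k m).

Definition coefQ (R : realType) (N k : nat) (g1 g2 rho1 : R) (n j : nat) : R :=
  if j == 1%N then 1 else
  rank_shift R N k n * g2 /
    (rho1 * gbar g1 g2 + (1 - rho1) * (rank_shift R N k n + 1) * g1).

Definition coefR (R : realType) (N k : nat) (g1 g2 rho1 : R) (n j : nat) : R :=
  if j == 1%N then 1 else
  (rank_shift R N k n + 1) * g1 /
    (rho1 * gbar g1 g2 + (1 - rho1) * (rank_shift R N k n + 1) * g1).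

Definition coefT (R : realType) (N k : nat) (g1 g2 : R) (m i : nat) : R :=
  if i == 1%N then 1 else
  rank_shift R N k m * g1 / ((rank_shift R N k m + 1) * g2).

Definition coefU (R : realType) (N k : nat) (g1 g2 rho2 : R) (m i : nat) : R :=
  if i == 1%N then g1 / g2 else
  (rank_shift R N k m + 1) * g1 /
    (rho2 * gbar g1 g2 + (1 - rho2) * (rank_shift R N k m + 1) * g2).

Definition first_hop_pdf (R : realType) (N k : nat) (g1 g2 rho1 x : R) : R :=
  k%:R / g1 * 'C(N, k)%:R *
  \sum_(0 <= n < k) \sum_(1 <= j < 3)
    coefP N k g1 g2 n * coefQ N k g1 g2 rho1 n j *
    expR (- (coefR N k g1 g2 rho1 n j * x / g1)).

Definition second_hop_cdf (R : realType) (N k : nat) (g1 g2 rho2 x : R) : R :=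
  1 - k%:R * 'C(N, k)%:R *
  \sum_(0 <= m < k) \sum_(1 <= i < 3)
    coefS N k g1 g2 m * coefT N k g1 g2 m i *
    expR (- (coefU N k g1 g2 rho2 m i * x / g1)).

Definition has_density_on_nonneg (R : realType) (d : measure_display)
    (T : measurableType d) (P : probability T R) (X : {RV P >-> R})
    (f : R -> R) : Prop :=
  forall A : set R, measurable A ->
    distribution P X A =
      (\int[lebesgue_measure]_(x in A `&` `[0%R, +oo[) (f x)%:E)%E.

Definition independent_rvs (R : realType) (d : measure_display)
    (T : measurableType d) (P : probability T R) (X Y : {RV P >-> R}) : Prop :=
  forall A B : set R, measurable A -> measurable B ->
    P (X @^-1` A `&` Y @^-1` B) = (P (X @^-1` A) * P (Y @^-1` B))%E.

(* At x = y = 0 the quotient sndr_ub reads 0 / 0, which is 0. *)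
Definition sndr (R : realType) (zeta x y : R) : R :=
  x * y / (zeta * y + x + zeta).

Definition sndr_ub (R : realType) (zeta x y : R) : R :=
  x * y / (x + zeta * y).

Definition log2 (R : realType) (x : R) : R := ln x / ln 2.

Definition ergodic_capacity (R : realType) (d : measure_display)
    (T : measurableType d) (P : probability T R) (G : T -> R) : \bar R :=
  ((2^-1)%:E * 'E_P[fun w => log2 (1 + G w)])%E.

Definition cexp (R : realType) (z : R[i]) : R[i] :=
  (expR (complex.Re z))%:C * (cos (complex.Im z) +i* sin (complex.Im z)).

(* x ^ z for a real base x > 0. *)
Definition cpow (R : realType) (x : R) (z : R[i]) : R[i] :=
  cexp ((ln x)%:C * z).

(* Lebesgue integral over D of a complex-valued function of a real variable. *)
Definition cintegral (R : realType) (D : set R) (f : R -> R[i]) : R[i] :=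
  Rintegral lebesgue_measure D (fun x => complex.Re (f x)) +i*
  Rintegral lebesgue_measure D (fun x => complex.Im (f x)).

(* Euler's integral: this is the Gamma function only on the half-plane
   0 < Re z, where all its arguments in foxH lie. *)
Definition cGamma (R : realType) (z : R[i]) : R[i] :=
  cintegral `]0, +oo[ (fun x => cpow x (z - 1) * (expR (- x))%:C).

(* The contour integral of f along the upward vertical line Re z = c. *)
Definition vline_integral (R : realType) (c : R) (f : R[i] -> R[i]) : R[i] :=
  (0 +i* 1) * cintegral [set: R] (fun y => f (c +i* y)).

(* L1 is the line Re s = c1 and L2 is the line Re t = c2. *)
Definition foxH (R : realType) (c1 c2 tau1 tau2 : R) : R[i] :=
  ((2 * pi)%:C * (0 +i* 1)) ^- 2 *
  vline_integral c1 (fun s => vline_integral c2 (fun t =>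
    cGamma (2 + s + t) * (cGamma (- s) * cGamma (1 + s)) *
    (cGamma (1 / 2 - t / 2) * cGamma (- (1 / 2) - t / 2)) *
    cpow tau1 s * cpow tau2 t)).

(* These constraints keep all the arguments of Gamma in foxH in the half-plane
   of positive real part. *)
Definition admissible_lines (R : realType) (c1 c2 : R) : Prop :=
  [/\ -1 < c1, c1 < 0, c2 < -1 & -2 < c1 + c2].

(* Main.v *)
Require Import Defs.
From mathcomp Require Import measurable_realfun.
From mathcomp Require Import ring lra.

(** Both sides reduce to integrals over the half-line.

    The H-function: the line integrals are evaluated one at a time, by exchanging each with the
    Euler integral of the Gamma factor Gamma(2 + s + t) (or of one of the remaining ones) and
    applying the Cahen-Mellin formula, which says that Gamma(s) x^(-s) integrates to
    2 pi e^(-x) along a vertical line. Gamma decays there like 1 / y^2 because Gamma(z) =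
    Gamma(z + 2) / (z (z + 1)), and inserting the Abel factor e^(-e |y|) turns the inversion into
    convergence of a Poisson kernel. This gives, with B(q) the integral of e^(-v - q / v) over
    v > 0,
      H(tau1, tau2) = 2 / tau2 * int_0^oo e^(-w) B((tau2 w)^2) / (1 + tau1 w) dw.

    The capacity: E ln(1 + g) is the integral of P(g > z) / (1 + z) over z > 0, and the bound
    XY / (X + zeta Y) exceeds z exactly when X > zeta z and Y > z X / (X - zeta z). For a term
    e^(-r x) of the density of X and a term e^(-u y) of the ccdf of Y, shifting x by zeta z turns
    this probability into e^(-p z) times the integral of e^(-r v - u zeta z^2 / v), where
    p = r zeta + u. Rescaling v by r and z by p yields the integral above with tau1 = 1 / p and
    tau2 = sqrt (r u zeta) / p. *)

Set Implicit Arguments.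
Unset Strict Implicit.
Unset Printing Implicit Defensive.

Local Open Scope classical_set_scope.
Local Open Scope ring_scope.
Local Open Scope complex_scope.

(** No contour is shifted and no residue is taken: every exchange is an instance of one Parseval
    identity. On a vertical line an Euler integral is the integral of [cis (y * ln w)] against a
    fixed weight in w, so y and w are tied only by a bounded phase and the double integrand is
    dominated by a product. Integrability of the two sides separately is then enough, and what
    Fubini produces is again integrable, so the exchanges can be chained. Gamma(2 + s + t) is the
    only factor that mixes s and t; its phase splits as [cis (y1 * ln w) * cis (y2 * ln w)], so the
    t-integral can be done first, with the s-phase kept in the weight. The product bound fails only
    for Cahen-Mellin itself, where the other factor in y is the constant 1. This is the reason for
    the Abel factor, which is removed by dominated convergence; that limit, like the later
    exchanges, rests on the integrability of Gamma along the line. *)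

(** * Domination and Fubini on the real line *)

Lemma integrable_measurable_fun (R : realType) (D : set R) (f : R -> R) :
  (@lebesgue_measure R).-integrable D (EFin \o f) -> measurable_fun D f.
Proof. by move=> intf; apply/measurable_EFinP; exact: measurable_int intf. Qed.

Lemma le_integrableR (R : realType) (D : set R) (f g : R -> R) : measurable D ->
  measurable_fun D f -> (@lebesgue_measure R).-integrable D (EFin \o g) ->
  (forall x, D x -> `|f x| <= g x) -> (@lebesgue_measure R).-integrable D (EFin \o f).
Proof.
move=> mD mf ig fg.
apply: (@le_integrable _ _ _ (@lebesgue_measure R) D mD _ (EFin \o g)) => //.
  by apply/measurable_EFinP.
by move=> x Dx; rewrite lee_fin (le_trans (fg _ Dx))// ler_norm.
Qed.

Lemma integrableZlR (R : realType) (D : set R) (r : R) (g : R -> R) : measurable D ->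
  (@lebesgue_measure R).-integrable D (EFin \o g) ->
  (@lebesgue_measure R).-integrable D (EFin \o (fun x => r * g x)).
Proof. by move=> mD; exact: (@integrableZl _ _ _ (@lebesgue_measure R) D mD r). Qed.

(** A product bound makes the iterated integral of the absolute value at most the product of the
    integrals of [|a|] and [|b|], so Tonelli applies. The bound holds at every point, hence every
    slice is integrable and not just almost every one; this is what allows [fine] to be removed
    inside the outer integral. *)
Lemma dominated_integrable_inner (R : realType) (f : R -> R -> R) (a b : R -> R) :
  let mu := @lebesgue_measure R in
  measurable_fun setT (fun z : R * R => f z.1 z.2) ->
  mu.-integrable setT (EFin \o a) -> mu.-integrable setT (EFin \o b) ->
  (forall y w, `|f y w| <= a y * b w) ->
  [/\ forall y, mu.-integrable setT (EFin \o f y),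
     (mu \x mu)%E.-integrable setT (fun z : R * R => (f z.1 z.2)%:E) &
     mu.-integrable setT (EFin \o (fun y => \int[mu]_w f y w))].
Proof.
move=> mu mf ia ib fab.
have ma : measurable_fun setT a by apply/measurable_EFinP; exact: (measurable_int mu ia).
have mb : measurable_fun setT b by apply/measurable_EFinP; exact: (measurable_int mu ib).
have ify y : mu.-integrable setT (EFin \o f y).
  apply: (@le_integrable _ _ _ mu setT measurableT _ (fun w => (a y)%:E * (EFin \o b) w)%E) => //.
  - apply/measurable_EFinP; exact: (measurableT_comp mf (measurable_pair1 y)).
  - by move=> w _ /=; rewrite lee_fin (le_trans (fab y w))// ler_norm.
  - exact: integrableZl.
pose g (z : R * R) := (f z.1 z.2)%:E.
have mg : measurable_fun setT g by apply/measurable_EFinP.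
have ig : (mu \x mu)%E.-integrable setT g.
  apply/integrable12ltyP => //.
  apply: (@le_lt_trans _ _ (\int[mu]_y (`|a y|%:E * \int[mu]_w `|b w|%:E))%E).
    apply: ge0_le_integral => //.
    - by move=> y _; apply: integral_ge0.
    - apply: (@measurable_fun_fubini_tonelli_F _ _ _ _ _ (@lebesgue_measure R) (abse \o g)) => //=.
      exact: measurableT_comp.
    - apply: emeasurable_funM; last exact: measurable_cst.
      by apply/measurable_EFinP/measurableT_comp.
    - move=> y _.
      rewrite -ge0_integralZl//; last first.
        by apply/measurable_EFinP/measurableT_comp.
      apply: ge0_le_integral => //.
      + apply/measurable_EFinP/measurableT_comp => //.
        exact: (measurableT_comp mf (measurable_pair1 y)).
      + apply: emeasurable_funM; first exact: measurable_cst.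
        by apply/measurable_EFinP/measurableT_comp.
      + move=> w _ /=; rewrite lee_fin (le_trans (fab y w))//.
        by rewrite -normrM ler_norm.
  have [_ foo] := integrableP _ _ _ ia.
  have [_ goo] := integrableP _ _ _ ib.
  rewrite ge0_integralZr//=; last 2 first.
    by apply/measurable_EFinP/measurableT_comp.
    by apply: integral_ge0.
  apply: lte_mul_pinfty => //.
    by apply: integral_ge0.
  rewrite ge0_fin_numE//.
  by apply: integral_ge0.
split => //.
have := integrable_fubini_F ig; apply: eq_integrable => // y _ /=.
by rewrite /Rintegral fineK//; exact: (integrable_fin_num _ (ify y)).
Qed.

Lemma dominated_Fubini (R : realType) (f : R -> R -> R) (a b : R -> R) :
  let mu := @lebesgue_measure R in
  measurable_fun setT (fun z : R * R => f z.1 z.2) ->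
  mu.-integrable setT (EFin \o a) -> mu.-integrable setT (EFin \o b) ->
  (forall y w, `|f y w| <= a y * b w) ->
  [/\ mu.-integrable setT (EFin \o (fun y => \int[mu]_w f y w)),
      mu.-integrable setT (EFin \o (fun w => \int[mu]_y f y w)) &
      \int[mu]_y (\int[mu]_w f y w) = \int[mu]_w (\int[mu]_y f y w)].
Proof.
move=> mu mf ia ib fab.
have mf' : measurable_fun setT (fun z : R * R => f z.2 z.1).
  apply: (@measurableT_comp _ _ _ _ _ _ _ _ (fun z : R * R => (z.2, z.1)) mf).
  exact: measurable_fun_pair.
have [ify ig iF] := dominated_integrable_inner mf ia ib fab.
have [ifw _ iG] := @dominated_integrable_inner _ (fun w y => f y w) b a mf' ib ia
  (fun w y => eq_ind_r (fun t => `|f y w| <= t) (fab y w) (mulrC _ _)).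
split => //.
rewrite /Rintegral; congr fine.
transitivity (\int[mu]_y \int[mu]_w (f y w)%:E)%E.
  apply: eq_integral => y _; rewrite fineK//; exact: integrable_fin_num (ify y).
rewrite (Fubini ig); apply: eq_integral => y _; rewrite fineK//=; exact: integrable_fin_num (ifw y).
Qed.

(** * Complex-valued integrals *)

Definition cis (R : realType) (t : R) : R[i] := cos t +i* sin t.

Lemma cisD (R : realType) (s t : R) : cis (s + t) = cis s * cis t.
Proof. by rewrite /cis cosD sinD; simpc; rewrite [X in _ +i* X]addrC. Qed.

Lemma cis0 (R : realType) : cis 0 = 1 :> R[i].
Proof. by rewrite /cis cos0 sin0. Qed.

Lemma cpowE (R : realType) (x a b : R) :
  cpow x (a +i* b) = (expR (ln x * a))%:C * cis (ln x * b).
Proof. by rewrite /cpow /cexp /cis; simpc. Qed.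

Definition cintegrable (R : realType) (D : set R) (f : R -> R[i]) :=
  (@lebesgue_measure R).-integrable D (EFin \o (fun x => complex.Re (f x))) /\
  (@lebesgue_measure R).-integrable D (EFin \o (fun x => complex.Im (f x))).

Lemma ReM (R : realType) (z w : R[i]) :
  complex.Re (z * w) = complex.Re z * complex.Re w - complex.Im z * complex.Im w.
Proof. by case: z; case: w. Qed.

Lemma ImM (R : realType) (z w : R[i]) :
  complex.Im (z * w) = complex.Re z * complex.Im w + complex.Im z * complex.Re w.
Proof. by case: z; case: w => *; rewrite /= addrC. Qed.

Lemma ReZ (R : realType) (r : R) (z : R[i]) : complex.Re (r%:C * z) = r * complex.Re z.
Proof. by rewrite ReM /= mul0r subr0. Qed.

Lemma ImZ (R : realType) (r : R) (z : R[i]) : complex.Im (r%:C * z) = r * complex.Im z.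
Proof. by rewrite ImM /= mul0r addr0. Qed.

Lemma complex_eqP (R : realType) (z w : R[i]) :
  complex.Re z = complex.Re w -> complex.Im z = complex.Im w -> z = w.
Proof. by case: z; case: w => /= ? ? ? ? -> ->. Qed.

Lemma realCM (R : realType) (x y : R) : (x * y)%:C = x%:C * y%:C.
Proof. exact: rmorphM. Qed.

(** The norm of [R[i]] takes its values in [R[i]]; this equivalent norm is real-valued, is still
    submultiplicative, and bounds both parts, so that real domination lemmas apply to each of
    them. *)
Definition norm1 (R : realType) (z : R[i]) : R := `|complex.Re z| + `|complex.Im z|.

Lemma norm1_ge0 (R : realType) (z : R[i]) : 0 <= norm1 z.
Proof. by rewrite addr_ge0. Qed.

Lemma Re_cintegral (R : realType) (D : set R) (f : R -> R[i]) :
  complex.Re (cintegral D f) = \int[lebesgue_measure]_(x in D) complex.Re (f x).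
Proof. by []. Qed.

Lemma Im_cintegral (R : realType) (D : set R) (f : R -> R[i]) :
  complex.Im (cintegral D f) = \int[lebesgue_measure]_(x in D) complex.Im (f x).
Proof. by []. Qed.

Lemma norm1M (R : realType) (z w : R[i]) : norm1 (z * w) <= norm1 z * norm1 w.
Proof.
rewrite /norm1 ReM ImM mulrDl !mulrDr -!normrM.
have := ler_normB (complex.Re z * complex.Re w) (complex.Im z * complex.Im w).
have := ler_normD (complex.Re z * complex.Im w) (complex.Im z * complex.Re w).
lra.
Qed.

Lemma Re_le_norm1 (R : realType) (z : R[i]) : `|complex.Re z| <= norm1 z.
Proof. by rewrite lerDl. Qed.

Lemma Im_le_norm1 (R : realType) (z : R[i]) : `|complex.Im z| <= norm1 z.
Proof. by rewrite lerDr. Qed.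

Lemma norm1_real (R : realType) (x : R) : norm1 x%:C = `|x|.
Proof. by rewrite /norm1 /= normr0 addr0. Qed.

Lemma norm1_cis (R : realType) (x : R) : norm1 (cis x) <= 2.
Proof.
rewrite /norm1 /cis /=.
have: `|cos x| <= 1 by rewrite ler_norml cos_geN1 cos_le1.
have: `|sin x| <= 1 by rewrite ler_norml sin_geN1 sin_le1.
lra.
Qed.

Lemma cintegrable_norm1 (R : realType) (D : set R) (f : R -> R[i]) : measurable D ->
  cintegrable D f ->
  (@lebesgue_measure R).-integrable D (EFin \o (fun x => norm1 (f x))).
Proof.
move=> mD [iR iI].
have -> : EFin \o (fun x => norm1 (f x)) =
  ((abse \o (EFin \o (fun x => complex.Re (f x)))) \+
   (abse \o (EFin \o (fun x => complex.Im (f x)))))%E by apply/funext.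
by apply: integrableD => //; exact: integrable_abse.
Qed.

Lemma cintegrable_measurable (R : realType) (D : set R) (f : R -> R[i]) :
  cintegrable D f ->
  measurable_fun D (fun x => complex.Re (f x)) /\ measurable_fun D (fun x => complex.Im (f x)).
Proof.
by move=> [iR iI]; split; exact: integrable_measurable_fun.
Qed.

Lemma le_cintegrable (R : realType) (D : set R) (f : R -> R[i]) (g : R -> R) : measurable D ->
  measurable_fun D (fun x => complex.Re (f x)) -> measurable_fun D (fun x => complex.Im (f x)) ->
  (@lebesgue_measure R).-integrable D (EFin \o g) ->
  (forall x, D x -> norm1 (f x) <= g x) -> cintegrable D f.
Proof.
move=> mD mR mI ig fg; split; apply: (le_integrableR _ _ ig) => // x Dx.
  exact: le_trans (Re_le_norm1 _) (fg _ Dx).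
exact: le_trans (Im_le_norm1 _) (fg _ Dx).
Qed.

Lemma eq_cintegral (R : realType) (D : set R) (f g : R -> R[i]) :
  (forall x, D x -> f x = g x) -> cintegral D f = cintegral D g.
Proof.
by move=> fg; apply: complex_eqP => /=; apply: eq_Rintegral => x /set_mem /fg ->.
Qed.

Lemma eq_cintegrable (R : realType) (D : set R) (f g : R -> R[i]) : measurable D ->
  (forall x, D x -> f x = g x) -> cintegrable D f -> cintegrable D g.
Proof.
move=> mD fg [iR iI]; split; [move: iR|move: iI]; apply: eq_integrable => // x /set_mem Dx /=;
  by rewrite fg.
Qed.

Lemma cintegrable_real (R : realType) (D : set R) (f : R -> R) : measurable D ->
  (@lebesgue_measure R).-integrable D (EFin \o f) -> cintegrable D (fun x => (f x)%:C).
Proof. by move=> mD ?; split => //=; exact: integrable0. Qed.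

Lemma cintegral_real (R : realType) (D : set R) (f : R -> R) :
  cintegral D (fun x => (f x)%:C) = (\int[lebesgue_measure]_(x in D) f x)%:C.
Proof. by apply: complex_eqP => //=; rewrite /Rintegral integral0. Qed.

Lemma cintegrableZl (R : realType) (D : set R) (c : R[i]) (f : R -> R[i]) : measurable D ->
  cintegrable D f -> cintegrable D (fun x => c * f x).
Proof.
move=> mD [iR iI]; split.
  have -> : EFin \o (fun x => complex.Re (c * f x)) =
    (fun x => (complex.Re c)%:E * (EFin \o (fun x => complex.Re (f x))) x -
             (complex.Im c)%:E * (EFin \o (fun x => complex.Im (f x))) x)%E.
    by apply/funext => x /=; rewrite ReM.
  by apply: integrableB => //; exact: integrableZl.
have -> : EFin \o (fun x => complex.Im (c * f x)) =
  (fun x => (complex.Re c)%:E * (EFin \o (fun x => complex.Im (f x))) x +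
           (complex.Im c)%:E * (EFin \o (fun x => complex.Re (f x))) x)%E.
  by apply/funext => x /=; rewrite ImM.
by apply: integrableD => //; exact: integrableZl.
Qed.

Lemma cintegralZl (R : realType) (D : set R) (c : R[i]) (f : R -> R[i]) : measurable D ->
  cintegrable D f -> cintegral D (fun x => c * f x) = c * cintegral D f.
Proof.
move=> mD [iR iI].
have iZ (r : R) g : (@lebesgue_measure R).-integrable D (EFin \o g) ->
  (@lebesgue_measure R).-integrable D (EFin \o (fun x => r * g x)).
  exact: integrableZlR.
apply: complex_eqP; rewrite ?ReM ?ImM /=.
  under eq_Rintegral do rewrite ReM.
  by rewrite RintegralB//; [rewrite !RintegralZl|exact: iZ..].
under eq_Rintegral do rewrite ImM.
by rewrite RintegralD//; [rewrite !RintegralZl|exact: iZ..].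
Qed.

(** The factor 2 comes from bounding the real and the imaginary part separately by the integral of
    [g]. *)
Lemma norm1_cintegral (R : realType) (D : set R) (f : R -> R[i]) (g : R -> R) :
  measurable D -> cintegrable D f -> (@lebesgue_measure R).-integrable D (EFin \o g) ->
  (forall x, D x -> norm1 (f x) <= g x) ->
  norm1 (cintegral D f) <= 2 * \int[lebesgue_measure]_(x in D) g x.
Proof.
move=> mD [iR iI] ig fg; rewrite mulr_natl mulr2n; apply: lerD.
  apply: (le_trans (@le_normr_Rintegral _ _ _ (@lebesgue_measure R) D _ mD iR)).
  apply: le_Rintegral => //; first exact: integrable_norm.
  by move=> x Dx; exact: le_trans (Re_le_norm1 _) (fg _ Dx).
apply: (le_trans (@le_normr_Rintegral _ _ _ (@lebesgue_measure R) D _ mD iI)).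
apply: le_Rintegral => //; first exact: integrable_norm.
by move=> x Dx; exact: le_trans (Im_le_norm1 _) (fg _ Dx).
Qed.

Lemma cintegral_mkcond (R : realType) (D : set R) (f : R -> R[i]) :
  cintegral D f = cintegral setT (fun x => if x \in D then f x else 0).
Proof.
by apply: complex_eqP => /=; rewrite Rintegral_mkcond; apply: eq_Rintegral => x _;
  rewrite patchE; case: ifP.
Qed.

Lemma cintegrable_mkcond (R : realType) (D : set R) (f : R -> R[i]) : measurable D ->
  cintegrable D f <-> cintegrable setT (fun x => if x \in D then f x else 0).
Proof.
move=> mD.
have H (g : R -> R) (h : R -> R) : (forall x, h x = if x \in D then g x else 0) ->
  (@lebesgue_measure R).-integrable D (EFin \o g) <->
  (@lebesgue_measure R).-integrable setT (EFin \o h).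
  move=> hg; rewrite (@integrable_mkcond _ _ _ (@lebesgue_measure R) D _ mD).
  have -> // : (EFin \o g) \_ D = EFin \o h.
  by apply/funext => x /=; rewrite patchE hg; case: ifP.
have HR := H (fun x => complex.Re (f x))
  (fun x => complex.Re (if x \in D then f x else 0)) (fun x => fun_if _ _ _ _).
have HI := H (fun x => complex.Im (f x))
  (fun x => complex.Im (if x \in D then f x else 0)) (fun x => fun_if _ _ _ _).
by rewrite /cintegrable; split => -[? ?]; split; [apply/HR|apply/HI|apply/HR|apply/HI].
Qed.

Lemma le_cintegrable_mulr (R : realType) (D : set R) (f g : R -> R[i]) (C : R) : measurable D ->
  measurable_fun D (fun x => complex.Re (g x)) -> measurable_fun D (fun x => complex.Im (g x)) ->
  (forall x, D x -> norm1 (g x) <= C) ->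
  cintegrable D f -> cintegrable D (fun x => g x * f x).
Proof.
move=> mD mgR mgI gC if_; have [mfR mfI] := cintegrable_measurable if_.
apply: (@le_cintegrable _ _ _ (fun x => C * norm1 (f x))) => //.
- by under eq_fun do rewrite ReM; apply: measurable_funB; exact: measurable_funM.
- by under eq_fun do rewrite ImM; apply: measurable_funD; exact: measurable_funM.
- by apply: integrableZlR => //; exact: cintegrable_norm1.
- move=> x Dx; rewrite (le_trans (norm1M _ _))// ler_wpM2r ?norm1_ge0//; exact: gC.
Qed.

(** * Exchanging a line integral with a phase integral *)

Section Parseval.
Variable R : realType.
Variables (L : R -> R) (D : set R) (Phi psi : R -> R[i]).
Hypotheses (mL : measurable_fun setT L) (mD : measurable D).
Hypotheses (iPhi : cintegrable setT Phi) (ipsi : cintegrable D psi).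
Let mu := @lebesgue_measure R.
(** Extension by zero, so that both variables range over the whole line as in [dominated_Fubini]. *)
Let psi' (x : R) : R[i] := if x \in D then psi x else 0.
Let F (y w : R) : R[i] := Phi y * (cis (y * L w) * psi' w).

Let mproj1 (f : R -> R) : measurable_fun setT f -> measurable_fun setT (fun z : R * R => f z.1).
Proof. by move=> mf; apply: measurableT_comp. Qed.

Let mproj2 (f : R -> R) : measurable_fun setT f -> measurable_fun setT (fun z : R * R => f z.2).
Proof. by move=> mf; apply: measurableT_comp. Qed.

Let mphase : measurable_fun setT (fun z : R * R => z.1 * L z.2).
Proof. by apply: measurable_funM; [exact: measurable_fst|exact: mproj2]. Qed.

Let mcos : measurable_fun setT (fun z : R * R => cos (z.1 * L z.2)).
Proof.
by apply: (@measurableT_comp _ _ _ _ _ _ (@cos R)) => //; apply: continuous_measurable_fun; exact: continuous_cos.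
Qed.

Let msin : measurable_fun setT (fun z : R * R => sin (z.1 * L z.2)).
Proof.
by apply: (@measurableT_comp _ _ _ _ _ _ (@sin R)) => //; apply: continuous_measurable_fun; exact: continuous_sin.
Qed.

Let ipsi' : cintegrable setT psi'.
Proof. exact: (iffLR (cintegrable_mkcond psi mD)). Qed.

Let mF : measurable_fun setT (fun z : R * R => complex.Re (F z.1 z.2)) /\
  measurable_fun setT (fun z : R * R => complex.Im (F z.1 z.2)).
Proof.
have [m1 m2] := cintegrable_measurable iPhi.
have [m3 m4] := cintegrable_measurable ipsi'.
have n1 := mproj1 m1; have n2 := mproj1 m2; have n3 := mproj2 m3; have n4 := mproj2 m4.
rewrite /F; split.
  under eq_fun do rewrite !ReM !ImM /=.
  by apply: measurable_funB; apply: measurable_funM => //;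
    [apply: measurable_funB|apply: measurable_funD]; exact: measurable_funM.
under eq_fun do rewrite !ImM !ReM /=.
by apply: measurable_funD; apply: measurable_funM => //;
  [apply: measurable_funD|apply: measurable_funB]; exact: measurable_funM.
Qed.

Let Fbound y w : norm1 (F y w) <= (2 * norm1 (Phi y)) * norm1 (psi' w).
Proof.
rewrite (le_trans (norm1M _ _))// (mulrC 2) -mulrA ler_wpM2l ?norm1_ge0//.
rewrite (le_trans (norm1M _ _))// ler_wpM2r ?norm1_ge0//.
exact: norm1_cis.
Qed.

Let FR := @dominated_Fubini R (fun y w => complex.Re (F y w)) (fun y => 2 * norm1 (Phi y))
  (fun w => norm1 (psi' w)) mF.1
  (integrableZlR 2 measurableT (cintegrable_norm1 measurableT iPhi)) (cintegrable_norm1 measurableT ipsi')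
  (fun y w => le_trans (Re_le_norm1 _) (Fbound y w)).

Let FI := @dominated_Fubini R (fun y w => complex.Im (F y w)) (fun y => 2 * norm1 (Phi y))
  (fun w => norm1 (psi' w)) mF.2
  (integrableZlR 2 measurableT (cintegrable_norm1 measurableT iPhi)) (cintegrable_norm1 measurableT ipsi')
  (fun y w => le_trans (Im_le_norm1 _) (Fbound y w)).

Let mcis_r y : measurable_fun setT (fun w => complex.Re (cis (y * L w))) /\
  measurable_fun setT (fun w => complex.Im (cis (y * L w))).
Proof.
by split; [exact: (measurableT_comp mcos (measurable_pair1 y))|
           exact: (measurableT_comp msin (measurable_pair1 y))].
Qed.

Let mcis_l (w : R) : measurable_fun setT (fun y : R => complex.Re (cis (y * L w))) /\
  measurable_fun setT (fun y : R => complex.Im (cis (y * L w))).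
Proof.
by split; [exact: (measurableT_comp mcos (measurable_pair2 w))|
           exact: (measurableT_comp msin (measurable_pair2 w))].
Qed.

Lemma cintegrable_phase_r y : cintegrable D (fun w => cis (y * L w) * psi w).
Proof.
have [mR mI] := mcis_r y.
apply: (@le_cintegrable_mulr _ _ _ _ 2) => //.
- exact: measurable_funTS.
- exact: measurable_funTS.
- by move=> w _; exact: norm1_cis.
Qed.

Lemma cintegrable_phase_l w : cintegrable setT (fun y => cis (y * L w) * Phi y).
Proof.
have [mR mI] := mcis_l w.
by apply: (@le_cintegrable_mulr _ _ _ _ 2) => // x _; exact: norm1_cis.
Qed.

Let innerE y : cintegral setT (F y) = Phi y * cintegral D (fun w => cis (y * L w) * psi w).
Proof.
rewrite -cintegralZl//; last exact: cintegrable_phase_r.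
rewrite [RHS]cintegral_mkcond; apply: eq_cintegral => w _.
by rewrite /F /psi'; case: ifP => //; rewrite !mulr0.
Qed.

Let outerE w : cintegral setT (F^~ w) =
  if w \in D then psi w * cintegral setT (fun y => cis (y * L w) * Phi y) else 0.
Proof.
case: ifPn => wD; last first.
  rewrite (@eq_cintegral _ _ _ (fun=> 0%:C)) ?cintegral_real.
    by rewrite /Rintegral integral0.
  by move=> y _; rewrite /F /psi' (negbTE wD) !mulr0.
rewrite -cintegralZl//; last exact: cintegrable_phase_l.
by apply: eq_cintegral => y _; rewrite /F /psi' wD; ring.
Qed.

(** This yields the integrability of what remains after the y-integration without any estimate of
    it; later exchanges rely on that. *)
Lemma phase_Fubini_integrable :
  cintegrable D (fun w => psi w * cintegral setT (fun y => cis (y * L w) * Phi y)).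
Proof.
apply: (iffRL (cintegrable_mkcond _ mD)).
have [_ iR _] := FR; have [_ iI _] := FI.
by apply: (@eq_cintegrable _ _ (fun w => cintegral setT (F^~ w))) => // w _; rewrite outerE.
Qed.

(** The phase, of [norm1] at most 2, is the only coupling between [y] and [w], so [dominated_Fubini]
    applies to both parts with a bound that is a product of [2 * norm1 (Phi y)] and
    [norm1 (psi' w)]. *)
Lemma phase_Fubini :
  cintegral setT (fun y => Phi y * cintegral D (fun w => cis (y * L w) * psi w)) =
  cintegral D (fun w => psi w * cintegral setT (fun y => cis (y * L w) * Phi y)).
Proof.
rewrite [RHS]cintegral_mkcond.
under [RHS]eq_cintegral do rewrite -outerE.
under eq_cintegral do rewrite -innerE.
have [_ _ eR] := FR; have [_ _ eI] := FI.
exact: complex_eqP.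
Qed.

Lemma phase_Fubini_integrable_l :
  cintegrable setT (fun y => Phi y * cintegral D (fun w => cis (y * L w) * psi w)).
Proof.
have [iR _ _] := FR; have [iI _ _] := FI.
by apply: (@eq_cintegrable _ _ (fun y => cintegral setT (F y))) => // y _; rewrite innerE.
Qed.

End Parseval.

(* The Gaussian weight below is only there to make Fubini applicable. *)
Lemma phase_measurable (R : realType) (L : R -> R) (D : set R) (psi : R -> R[i]) :
  measurable_fun setT L -> measurable D -> cintegrable D psi ->
  measurable_fun setT (fun y : R => complex.Re (cintegral D (fun w => cis (y * L w) * psi w))) /\
  measurable_fun setT (fun y : R => complex.Im (cintegral D (fun w => cis (y * L w) * psi w))).
Proof.
move=> mL mD ipsi.
have ig : cintegrable setT (fun y : R => (gauss_fun y)%:C).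
  by apply: cintegrable_real => //; exact: integrableT_gauss.
have [mR mI] := cintegrable_measurable (phase_Fubini_integrable_l mL mD ig ipsi).
have g0 (y : R) : gauss_fun y != 0 by rewrite gt_eqF// expR_gt0.
have mg : measurable_fun setT (fun y : R => (gauss_fun y)^-1).
  rewrite /gauss_fun; under eq_fun do rewrite -expRN opprK.
  by apply: continuous_measurable_fun => x; apply: continuous_comp;
    [exact: exprn_continuous|exact: continuous_expR].
have ReE (r : R) (z : R[i]) : r != 0 -> r^-1 * complex.Re (r%:C * z) = complex.Re z.
  by move=> r0; rewrite ReM /= mul0r subr0 mulrA mulVf ?mul1r.
have ImE (r : R) (z : R[i]) : r != 0 -> r^-1 * complex.Im (r%:C * z) = complex.Im z.
  by move=> r0; rewrite ImM /= mul0r addr0 mulrA mulVf ?mul1r.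
split.
  have := measurable_funM mg mR; congr (measurable_fun _ _).
  by apply/funext => y; exact: ReE.
have := measurable_funM mg mI; congr (measurable_fun _ _).
by apply/funext => y; exact: ImE.
Qed.

(** * Change of variables and the fundamental theorem on the half-line *)

(** By uniqueness of Lebesgue measure: the pushforward under x -> a x + b, multiplied by [|a|],
    gives every interval []u, v]] its length. *)
Lemma ge0_integral_affine (R : realType) (a b : R) (f : R -> \bar R) : a != 0 ->
  measurable_fun setT f -> (forall x, 0 <= f x)%E ->
  (\int[lebesgue_measure]_x f x = `|a|%:E * \int[lebesgue_measure]_x f (a * x + b)%R)%E.
Proof.
move=> a0 mf f0; set mu := @lebesgue_measure R.
pose phi (x : R) := a * x + b.
have mphi : @measurable_fun _ _ (measurableTypeR R) (measurableTypeR R) setT phi.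
  by apply: measurable_funD => //; exact: measurable_funM.
pose k := NngNum (normr_ge0 a).
pose pm : {measure set (measurableTypeR R) -> \bar R} :=
  measure_function_pushforward__canonical__measure_function_Measure mu mphi.
pose nu : {measure set (measurableTypeR R) -> \bar R} := mscale k pm.
have nuE A : measurable A -> mu A = nu A.
  apply: lebesgue_measure_unique => X [[u v] _ <-] /=.
  rewrite /nu /mscale /= /pushforward.
  have [a_gt0|a_lt0|/eqP] := ltgtP 0 a; last by rewrite eq_sym (negbTE a0).
  - have -> : phi @^-1` `]u, v] = `](u - b) / a, (v - b) / a]%classic.
      apply/seteqP; split => x /=; rewrite !in_itv /= /phi;
      by rewrite ltr_pdivrMr// ler_pdivlMr// ltrBlDr lerBrDr mulrC.
    rewrite /mu !lebesgue_measure_itv/= !lte_fin ltr_pM2r ?invr_gt0// ltrD2r.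
    case: ifP => _; last by rewrite mule0.
    by rewrite -!EFinB -EFinM gtr0_norm//; congr EFin; field.
  (* A negative slope moves the closed end of the interval to the left, which does not change its
     length. *)
  - have -> : phi @^-1` `]u, v] = `[(v - b) / a, (u - b) / a[%classic.
      apply/seteqP; split => x /=; rewrite !in_itv /= /phi;
      by rewrite ltr_ndivlMr// ler_ndivrMr// ltrBlDr lerBrDr mulrC andbC.
    rewrite /mu !lebesgue_measure_itv/= !lte_fin ltr_nM2r ?invr_lt0// ltrD2r.
    case: ifP => _; last by rewrite mule0.
    by rewrite -!EFinB -EFinM ltr0_norm//; congr EFin; field.
transitivity (\int[nu]_x f x)%E.
  by apply: eq_measure_integral => A mA _; exact: nuE.
rewrite /nu ge0_integral_mscale//.
by rewrite ge0_integral_pushforward.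
Qed.

Lemma integrable_scale (R : realType) (a : R) (f : R -> R) : a != 0 ->
  let mu := @lebesgue_measure R in
  mu.-integrable setT (EFin \o f) ->
  mu.-integrable setT (EFin \o (fun x => f (a * x))) /\
  \int[mu]_x f x = `|a| * \int[mu]_x f (a * x).
Proof.
move=> a0 mu intf.
have na : 0 < `|a| by rewrite normr_gt0.
have mf : measurable_fun setT f by exact: integrable_measurable_fun intf.
have mf' : measurable_fun setT (EFin \o f) by apply/measurable_EFinP.
have mfa : measurable_fun setT (fun x => f (a * x)).
  by apply: measurableT_comp => //; exact: measurable_funM.
have H (g : R -> \bar R) : measurable_fun setT g -> (forall x, 0 <= g x)%E ->
    (\int[mu]_x g x = `|a|%:E * \int[mu]_x g (a * x)%R)%E.
  move=> mg g0; rewrite (@ge0_integral_affine _ a 0)//; congr (_ * _)%E.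
  by apply: eq_integral => x _; rewrite addr0.
have ia : mu.-integrable setT (EFin \o (fun x => f (a * x))).
  apply/integrableP; split; first by apply/measurable_EFinP.
  have /integrableP[_] := intf.
  rewrite H//; last by apply: measurableT_comp.
  (* Were the rescaled integral infinite, its product with [|a| > 0] would be infinite too. *)
  rewrite lt_neqAle => /andP[+ _].
  rewrite ltey; apply: contra => /eqP ->.
  by rewrite gt0_muley// lte_fin.
split => //.
have m1 : measurable_fun setT ((EFin \o f)^\+)%E by apply: measurable_funepos; exact: mf'.
have m2 : measurable_fun setT ((EFin \o f)^\-)%E by apply: measurable_funeneg; exact: mf'.
rewrite /Rintegral integralE (H _ m1 (funepos_ge0 _)) (H _ m2 (funeneg_ge0 _)).
rewrite [in RHS]integralE.
have e1 : (\int[mu]_x ((EFin \o f)^\+ (a * x)%R) =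
    \int[mu]_x (EFin \o (fun x => f (a * x)%R))^\+ x)%E.
  by apply: eq_integral => x _; rewrite !funepos.unlock.
have e2 : (\int[mu]_x ((EFin \o f)^\- (a * x)%R) =
    \int[mu]_x (EFin \o (fun x => f (a * x)%R))^\- x)%E.
  by apply: eq_integral => x _; rewrite !funeneg.unlock.
rewrite e1 e2.
have p := integrable_pos_fin_num measurableT ia.
have q := integrable_neg_fin_num measurableT ia.
by rewrite -(fineK p) -(fineK q) -!EFinM -!EFinB /= mulrBr.
Qed.

Lemma integral_opp (R : realType) (f : R -> R) :
  (@lebesgue_measure R).-integrable setT (EFin \o f) ->
  \int[lebesgue_measure]_x f (- x) = \int[lebesgue_measure]_x f x.
Proof.
move=> intf; have [||_ ->] := @integrable_scale _ (-1) f => //.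
rewrite normrN1 mul1r; apply: eq_Rintegral => x _; by rewrite mulN1r.
Qed.

Lemma cintegral_scale (R : realType) (a : R) (f : R -> R[i]) : a != 0 ->
  cintegrable setT f ->
  cintegrable setT (fun x => f (a * x)) /\
  cintegral setT f = `|a|%:C * cintegral setT (fun x => f (a * x)).
Proof.
move=> a0 [/(integrable_scale a0)[iR eR] /(integrable_scale a0)[iI eI]].
by split=> //; apply: complex_eqP; rewrite ?ReZ ?ImZ ?Re_cintegral ?Im_cintegral.
Qed.

Section halfline_FTC.
Variable R : realType.
Variables (f F : R -> R) (l0 l1 : R).
Let mu := @lebesgue_measure R.
Hypothesis dF : forall x : R, 0 < x -> is_derive x (1 : R) F (f x).
Hypothesis cf : forall x : R, 0 < x -> {for x, continuous f}.
Hypothesis F0 : F x @[x --> 0^'+] --> l0.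
Hypothesis Foo : F x @[x --> +oo] --> l1.

(** The half-line is exhausted by the intervals [1 / (n + 1), n + 2]; the shift to n + 2 makes
    already the first one, [1, 2], nondegenerate. *)
Let a_ (n : nat) : R := n.+1%:R^-1.
Let b_ (n : nat) : R := n.+2%:R.

Let a_gt0 n : 0 < a_ n. Proof. by rewrite invr_gt0. Qed.

Let ab n : a_ n < b_ n.
Proof.
by rewrite (@le_lt_trans _ _ 1) ?ltr1n// /a_ invf_le1 ?ler1n.
Qed.

Lemma measurable_fun_halfline : measurable_fun (`]0, +oo[ : set R) f.
Proof.
apply: open_continuous_measurable_fun; first exact: interval_open.
by move=> x; rewrite inE/= in_itv/= andbT; exact: cf.
Qed.

Let FTC_piece n : (\int[mu]_(x in `[a_ n, b_ n]) (f x)%:E = (F (b_ n))%:E - (F (a_ n))%:E)%E.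
Proof.
have pos x : x \in `[a_ n, b_ n] -> 0 < x.
  by rewrite in_itv/= => /andP[+ _]; exact: lt_le_trans.
have cF x : 0 < x -> {for x, continuous F}.
  move=> x0; apply: differentiable_continuous; apply/derivable1_diffP.
  by have [] := dF x0.
apply: continuous_FTC2 => //.
- by apply: continuous_in_subspaceT => x /[!inE]/= xab; exact/cf/pos.
- split.
  + move=> x /[!in_itv]/= /andP[ax _].
    by have [] := dF (lt_trans (a_gt0 n) ax).
  + by apply: cvg_at_right_filter; exact: cF.
  + by apply: cvg_at_left_filter; apply: cF; exact: lt_trans (ab n).
- move=> x /[!in_itv]/= /andP[ax _].
  by rewrite derive1E; have /@derive_val -> := dF (lt_trans (a_gt0 n) ax).
Qed.

Let cvgF : (F (b_ n) - F (a_ n)) @[n --> \oo] --> l1 - l0.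
Proof.
apply: cvgB.
- apply: (@cvg_comp _ _ _ b_ F _ +oo%R); last exact: Foo.
  apply/cvgryPge => M; near=> n.
  rewrite /b_ (@le_trans _ _ n%:R)//; last by rewrite ler_nat -addn2 leq_addr.
  near: n; exact: nbhs_infty_ger.
- move/cvg_at_rightP : F0; apply; split => //; exact: cvg_harmonic.
Unshelve. all: by end_near. Qed.

Let nd_ab : nondecreasing_seq (fun n => `[a_ n, b_ n]%classic).
Proof.
move=> m n mn; apply/subsetPset => x /=; rewrite !in_itv/= => /andP[h1 h2].
rewrite (le_trans _ h1) ?(le_trans h2)//.
  by rewrite ler_nat !ltnS.
by rewrite lef_pV2 ?posrE// ler_nat ltnS.
Qed.

Let mem_ab (x : R) : 0 < x -> \forall n \near \oo, x \in `[a_ n, b_ n].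
Proof.
move=> x0; near=> n; rewrite in_itv/=; apply/andP; split.
  rewrite /a_ -[leRHS]invrK lef_pV2 ?posrE ?invr_gt0//.
  rewrite (@le_trans _ _ n%:R)//; last by rewrite ler_nat.
  near: n; exact: nbhs_infty_ger.
rewrite /b_ (@le_trans _ _ n%:R)//; last by rewrite ler_nat -addn2 leq_addr.
near: n; exact: nbhs_infty_ger.
Unshelve. all: by end_near. Qed.

Let ab_pos n (x : R) : x \in `[a_ n, b_ n] -> 0 < x.
Proof. by rewrite in_itv/= => /andP[h1 _]; exact: lt_le_trans h1. Qed.

Let bigcup_ab : \bigcup_n `[a_ n, b_ n]%classic = `]0, +oo[%classic.
Proof.
apply/seteqP; split => x /=.
  by move=> [n _ /= /ab_pos x0]; rewrite in_itv/= x0.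
rewrite in_itv/= andbT => /mem_ab [n _ /(_ n (leqnn n))] xn.
by exists n.
Qed.

(** Monotone convergence along the exhaustion. Integrability is an outcome here, as
    [ge0_halfline_integrable] records. *)
Lemma ge0_halfline_FTC : (forall x : R, 0 < x -> 0 <= f x) ->
  (\int[mu]_(x in `]0%R, +oo[) (f x)%:E = (l1 - l0)%:E)%E.
Proof.
move=> f_ge0; have mf := measurable_fun_halfline.
have H := @ge0_nondecreasing_set_cvg_integral _ (measurableTypeR R) _ (fun n => `[a_ n, b_ n]%classic)
  (EFin \o f) mu nd_ab.
rewrite bigcup_ab in H.
have C : (\int[mu]_(x in `[a_ n, b_ n]) (f x)%:E)%E @[n --> \oo] --> (l1 - l0)%:E.
  under eq_fun do rewrite FTC_piece -EFinB.
  by apply: cvg_EFin; [exact: nearW|exact: cvgF].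
rewrite -(cvg_lim (@ereal_hausdorff R) C); apply/esym/cvg_lim => //; apply: H => //.
- move=> n; apply/measurable_EFinP; apply: measurable_funS mf => //.
  by move=> x /= /ab_pos x0; rewrite in_itv/= x0.
- by move=> n x /= /ab_pos x0; rewrite lee_fin f_ge0.
Qed.

Lemma ge0_halfline_integrable : (forall x : R, 0 < x -> 0 <= f x) ->
  mu.-integrable `]0, +oo[ (EFin \o f).
Proof.
move=> f_ge0; apply/integrableP; split.
  by apply/measurable_EFinP; exact: measurable_fun_halfline.
rewrite (_ : (\int[mu]_(x in _) _)%E = (l1 - l0)%:E) ?ltry//.
rewrite -ge0_halfline_FTC//; apply: eq_integral => x /[!inE]/= /[!in_itv]/=.
by rewrite andbT => x0; rewrite ger0_norm// f_ge0.
Qed.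

(** For a signed integrand the truncations to the exhausting intervals are dominated by [|f|]. *)
Lemma halfline_FTC : mu.-integrable `]0, +oo[ (EFin \o f) ->
  \int[mu]_(x in `]0, +oo[) f x = l1 - l0.
Proof.
move=> intf; have mf := measurable_fun_halfline.
have abS n : `[a_ n, b_ n]%classic `<=` `]0, +oo[.
  by move=> x /= /ab_pos x0; rewrite in_itv/= x0.
suff : (\int[mu]_(x in `]0%R, +oo[) (f x)%:E = (l1 - l0)%:E)%E by rewrite /Rintegral => ->.
have C : (\int[mu]_(x in `[a_ n, b_ n]) (f x)%:E)%E @[n --> \oo] --> (l1 - l0)%:E.
  under eq_fun do rewrite FTC_piece -EFinB.
  by apply: cvg_EFin; [exact: nearW|exact: cvgF].
have E n : (\int[mu]_(x in `[a_ n, b_ n]) (f x)%:E =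
    \int[mu]_(x in `]0%R, +oo[) ((EFin \o f) \_ (`[a_ n, b_ n]%classic)) x)%E.
  by rewrite -integral_mkcondr setIidr//; exact: abS.
rewrite -(cvg_lim (@ereal_hausdorff R) C); apply/esym/cvg_lim => //.
under eq_fun do rewrite E.
apply: (@dominated_cvg _ _ _ mu _ _ _ _ (abse \o (EFin \o f))) => //.
- move=> n; apply/measurable_restrict => //.
  rewrite (setIidr (abS n)).
  apply/measurable_EFinP; apply: measurable_funS mf => //; exact: abS.
- move=> x /=; rewrite in_itv/= andbT => /mem_ab xn.
  apply: cvg_near_cst; near=> n; rewrite patchE ifT//.
  by rewrite inE/=; near: n.
- exact: integrable_abse.
- by move=> n x _; rewrite patchE; case: ifP => //= _; rewrite normr0 lee_fin.
Unshelve. all: by end_near. Qed.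

End halfline_FTC.

Lemma cvgy_ln (R : realType) : @ln R x @[x --> +oo] --> +oo.
Proof.
apply/cvgryPge => M; near=> x.
have Mx : expR M <= x by near: x; apply: nbhs_pinfty_ge; rewrite num_real.
by rewrite -[leLHS]expRK ler_ln ?posrE ?expR_gt0// (lt_le_trans _ Mx) ?expR_gt0.
Unshelve. all: by end_near. Qed.

Lemma cvg0_dominated (R : realType) (T : Type) (F : set_system T)
  {FF : Filter F} (f g : T -> R) :
  (\forall x \near F, `|f x| <= g x) -> g @ F --> (0 : R) -> f @ F --> (0 : R).
Proof.
move=> fg g0.
have gN : (fun x => - g x) @ F --> (0 : R) by rewrite -(@oppr0 R); apply: cvgN.
by apply: (squeeze_cvgr _ gN g0); apply: filterS fg => x; rewrite ler_norml.
Qed.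

Lemma cvgy_inv (R : realType) : (fun x : R => x^-1) @ +oo --> (0 : R).
Proof.
apply/cvgrPdist_le => e e0; near=> x.
have ex : e^-1 <= x by near: x; apply: nbhs_pinfty_ge; rewrite num_real.
have x0 : 0 < x by rewrite (lt_le_trans _ ex)// invr_gt0.
by rewrite sub0r normrN gtr0_norm ?invr_gt0// -[leRHS]invrK lef_pV2 ?posrE ?invr_gt0.
Unshelve. all: by end_near. Qed.

(** The substitution t = ln x cannot start at 0, where ln tends to minus infinity. It is made on [1
    / (n + 1), +oo[, and monotone convergence is applied on both sides, the images exhausting the
    whole line. *)
Lemma ge0_integral_ln_subst (R : realType) (G : R -> R) : continuous G -> (forall x, 0 <= G x) ->
  (\int[lebesgue_measure]_(x in `]0%R, +oo[) (G (ln x) / x)%:E =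
   \int[lebesgue_measure]_x (G x)%:E)%E.
Proof.
move=> cG G0; set mu := @lebesgue_measure R.
pose a_ (n : nat) : R := n.+1%:R^-1.
have a_gt0 n : 0 < a_ n by rewrite invr_gt0.
have a_anti m n : (m <= n)%N -> a_ n <= a_ m.
  by move=> mn; rewrite lef_pV2 ?posrE// ler_nat ltnS.
have mG : measurable_fun setT G by exact: continuous_measurable_fun.
have piece n : (\int[mu]_(x in `[ln (a_ n), +oo[) (G x)%:E =
    \int[mu]_(x in `[a_ n, +oo[) (G (ln x) / x)%:E)%E.
  have pos (x : R) : x \in `]a_ n, +oo[ -> 0 < x.
    by rewrite in_itv/= andbT; exact: lt_trans.
  have dlnE (x : R) : 0 < x -> (@ln R)^`()%classic x = x^-1.
    by move=> x0; rewrite derive1E; have /@derive_val -> := is_derive1_ln x0.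
  have near_pos (x : R) : 0 < x -> \forall y \near x, (@ln R)^`()%classic y = y^-1.
    by move=> x0; near=> y; apply: dlnE; near: y; exact: lt_nbhsr.
  rewrite (@increasing_ge0_integration_by_substitutiony R (@ln R) G (a_ n)) => //.
  - apply: eq_integral => x /[!inE]/= /[!in_itv]/= /[!andbT] ax.
    by rewrite /= !fctE dlnE// (lt_le_trans _ ax).
  - move=> x y /[!in_itv]/= /[!andbT] ax ay xy.
    by rewrite ltr_ln ?posrE// ?(lt_le_trans _ ax) ?(lt_le_trans _ ay).
  - move=> x /pos x0.
    rewrite /continuous_at dlnE//.
    apply: (@cvg_trans _ ((fun y : R => y^-1) @ x)); last first.
      by apply: inv_continuous; rewrite gt_eqF.
    by apply: near_eq_cvg; near=> y; apply/esym; near: y; exact: near_pos.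
  - apply/cvg_ex; exists (a_ n)^-1.
    apply: (@cvg_trans _ ((fun y : R => y^-1) @ (a_ n)^'+)).
      by apply: near_eq_cvg; near=> y; rewrite dlnE// (lt_trans (a_gt0 n)).
    by apply: cvg_at_right_filter; apply: inv_continuous; rewrite gt_eqF.
  - apply/cvg_ex; exists 0.
    apply: (@cvg_trans _ ((fun y : R => y^-1) @ +oo%R)).
      by apply: near_eq_cvg; near=> y; rewrite dlnE.
    exact: cvgy_inv.
  - split; first by move=> x /pos x0; have [] := is_derive1_ln x0.
    by apply: cvg_at_right_filter; exact: continuous_ln.
  - exact: cvgy_ln.
  - by apply: continuous_in_subspaceT => x _; exact: cG.
have UL : \bigcup_n `[ln (a_ n), +oo[%classic = [set: R].
  apply/seteqP; split => // x _.
  have [n nx] : exists n : nat, expR (- x) <= n%:R.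
    by exists (Num.truncn (expR (- x))).+1; apply/ltW; exact: Num.Theory.truncnS_gt.
  exists n => //=; rewrite in_itv/= andbT -[leRHS]expRK ler_ln ?posrE ?expR_gt0//.
  rewrite /a_ -[x in leRHS]opprK expRN lef_pV2 ?posrE ?expR_gt0//.
  by rewrite (le_trans nx)// ler_nat.
have UR : \bigcup_n `[a_ n, +oo[%classic = (`]0, +oo[%classic : set R).
  apply/seteqP; split => x /=.
    by move=> [n _ /=]; rewrite !in_itv/= !andbT; exact: lt_le_trans.
  rewrite in_itv/= andbT => x0.
  exists (Num.truncn x^-1) => //=; rewrite in_itv/= andbT -[leRHS]invrK lef_pV2 ?posrE ?invr_gt0//.
  by apply/ltW; exact: Num.Theory.truncnS_gt.
have ndL : nondecreasing_seq (fun n => `[ln (a_ n), +oo[%classic : set R).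
  move=> m n mn; apply/subsetPset => x /=; rewrite !in_itv/= !andbT; apply: le_trans.
  by rewrite ler_ln ?posrE ?a_gt0// a_anti.
have ndR : nondecreasing_seq (fun n => `[a_ n, +oo[%classic : set R).
  move=> m n mn; apply/subsetPset => x /=; rewrite !in_itv/= !andbT; apply: le_trans.
  exact: a_anti.
have HL := @ge0_nondecreasing_set_cvg_integral _ (measurableTypeR R) _ _ (EFin \o G) mu ndL.
have HR := @ge0_nondecreasing_set_cvg_integral _ (measurableTypeR R) _ _
  (EFin \o (fun x => G (ln x) / x)) mu ndR.
rewrite UL in HL; rewrite UR in HR.
transitivity (limn (fun n => \int[mu]_(x in `[a_ n, +oo[) (G (ln x) / x)%:E)%E).
- apply/esym/cvg_lim => //; apply: HR => //.
  + move=> n; apply/measurable_EFinP; apply: measurable_funM.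
      by apply: measurableT_comp => //; apply: measurable_funTS; exact: measurable_ln.
    apply: (@measurable_funS _ _ _ _ (`]0, +oo[ : set R)) => //.
      by move=> x /=; rewrite !in_itv/= !andbT; exact: lt_le_trans.
    apply: open_continuous_measurable_fun; first exact: interval_open.
    move=> x; rewrite inE/= in_itv/= andbT => x0.
    by apply: inv_continuous; rewrite gt_eqF.
  + move=> n x /=; rewrite in_itv/= andbT => ax.
    by rewrite lee_fin divr_ge0// (le_trans _ ax)// ltW.
- apply/cvg_lim => //.
  under eq_fun do rewrite -piece.
  apply: HL => //; first by move=> n; apply/measurable_EFinP; exact: measurable_funTS.
  by move=> n x _; rewrite lee_fin.
Unshelve. all: by end_near. Qed.

Lemma ge0_even_integral (R : realType) (f : R -> R) : (forall x, 0 <= f x) ->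
  continuous f -> (forall x, f (- x) = f x) ->
  (\int[lebesgue_measure]_x (f x)%:E =
   2%:E * \int[lebesgue_measure]_(x in `]0%R, +oo[) (f x)%:E)%E.
Proof.
move=> f0 cf fe; rewrite ge0_symfun_integralT//; last by move=> x /=; rewrite fe.
rewrite (_ : [set x : R | 0 <= x] = `[0, +oo[%classic); last first.
  by apply/seteqP; split => x /=; rewrite in_itv/= andbT.
rewrite integral_itv_obnd_cbnd//.
by apply/measurable_EFinP; apply: measurable_funTS; exact: continuous_measurable_fun.
Qed.

Lemma integral_oneDsqrV (R : realType) :
  (\int[lebesgue_measure]_x ((1 + x ^+ 2)^-1)%:E = (pi : R)%:E)%E.
Proof.
have c1 : continuous (fun x : R => (1 + x ^+ 2)^-1) by exact: continuous_oneDsqrV.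
have p1 (x : R) : 0 <= (1 + x ^+ 2)^-1 by rewrite invr_ge0 addr_ge0// sqr_ge0.
rewrite ge0_even_integral//; last by move=> x; rewrite sqrrN.
rewrite (@ge0_halfline_FTC _ _ (@atan R) 0 (pi / 2)) //.
- by rewrite subr0 -EFinM; congr EFin; field.
- by move=> x _; exact: c1.
- by apply: cvg_at_right_filter; rewrite -[X in _ --> X](@atan0 R); exact: continuous_atan.
- exact: cvgy_atan.
Qed.

Lemma integrable_oneDsqrV (R : realType) :
  (@lebesgue_measure R).-integrable setT (EFin \o (fun x : R => (1 + x ^+ 2)^-1)).
Proof.
apply/integrableP; split.
  by apply/measurable_EFinP; apply: continuous_measurable_fun; exact: continuous_oneDsqrV.
rewrite (_ : (\int[_]_(x in _) _)%E = (pi : R)%:E) ?ltry//.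
rewrite -integral_oneDsqrV; apply: eq_integral => x _ /=.
by rewrite ger0_norm// invr_ge0 addr_ge0// sqr_ge0.
Qed.

Lemma eq_is_derive (R : realType) (f g : R -> R) (x df dg : R) :
  is_derive x (1 : R) f df -> (forall t, f t = g t) -> df = dg -> is_derive x (1 : R) g dg.
Proof. by move=> + /funext <- <-. Qed.

Lemma is_derive_comp (R : realType) (h h' g : R -> R) (x dg : R) :
  (forall y, is_derive y (1 : R) h (h' y)) -> is_derive x (1 : R) g dg ->
  is_derive x (1 : R) (fun x => h (g x)) (h' (g x) * dg).
Proof. by move=> dh dg'; exact: (@is_derive1_comp R h g x _ _ (dh (g x)) dg'). Qed.

Lemma is_derive_expRM (R : realType) (e x : R) :
  is_derive x (1 : R) (fun x => expR (e * x)) (e * expR (e * x)).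
Proof.
apply: (eq_is_derive (is_derive1_comp (is_derive_expR (e * x))
  (is_deriveZ e (is_derive_id x 1)))) => //.
by rewrite /GRing.scale /= mulr1 mulrC.
Qed.

Lemma cvgy_expRN (R : realType) (e : R) : 0 < e ->
  (fun x : R => expR (- e * x)) @ +oo --> (0 : R).
Proof.
move=> e0; apply/cvgrPdist_le => d d0; near=> x.
have xb : (e * d)^-1 <= x by near: x; apply: nbhs_pinfty_ge; rewrite num_real.
rewrite sub0r normrN gtr0_norm ?expR_gt0// mulNr expRN -[leRHS]invrK.
rewrite lef_pV2 ?posrE ?expR_gt0 ?invr_gt0//.
apply: (@le_trans _ _ (1 + e * x)); last exact: expR_ge1Dx.
rewrite -(ler_pM2l e0) invfM mulrA divff ?gt_eqF// mul1r in xb.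
lra.
Unshelve. all: by end_near. Qed.

(** * The Poisson kernel *)

Section Poisson.
Variables (R : realType) (e L : R).
Hypothesis e0 : 0 < e.
Let mu := @lebesgue_measure R.

Let ce : continuous (fun x : R => expR (- e * x)).
Proof. by move=> x; apply: continuous_comp; [exact: mulrl_continuous|exact: continuous_expR]. Qed.

Let ccos : continuous (fun x : R => cos (L * x)).
Proof. by move=> x; apply: continuous_comp; [exact: mulrl_continuous|exact: continuous_cos]. Qed.

Let csin : continuous (fun x : R => sin (L * x)).
Proof. by move=> x; apply: continuous_comp; [exact: mulrl_continuous|exact: continuous_sin]. Qed.

Lemma integral_expRN : (\int[mu]_(x in `]0%R, +oo[) (expR (- e * x))%:E = (e^-1)%:E)%E.
Proof.
pose F (x : R) : R := (- e)^-1 * expR (- e * x).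
have cF : continuous F by move=> x; apply: cvgM; [exact: cvg_cst|exact: ce].
have dF (x : R) : 0 < x -> is_derive x (1 : R) F (expR (- e * x)).
  move=> _; apply: (eq_is_derive (is_deriveZ (- e)^-1 (is_derive_expRM (- e) x))) => //.
  by rewrite /GRing.scale /= mulrA mulVf ?mul1r// oppr_eq0 gt_eqF.
have F0 : F x @[x --> 0^'+] --> - e^-1.
  by apply: cvg_at_right_filter; have := cF 0; rewrite /continuous_at /F mulr0 expR0 mulr1 invrN.
have Foo : F x @[x --> +oo] --> 0.
  by rewrite -(mulr0 (- e)^-1); apply: cvgM; [exact: cvg_cst|exact: cvgy_expRN].
have cf (x : R) : 0 < x -> {for x, continuous (fun x => expR (- e * x))}.
  by move=> _; exact: ce.
by rewrite (ge0_halfline_FTC dF cf F0 Foo) ?sub0r ?opprK// => x _; exact: expR_ge0.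
Qed.

Lemma integrable_expRN : mu.-integrable (`]0, +oo[ : set R) (EFin \o (fun x => expR (- e * x))).
Proof.
apply/integrableP; split.
  by apply/measurable_EFinP; apply: measurable_funTS; exact: continuous_measurable_fun.
rewrite (_ : (\int[_]_(x in _) _)%E = (e^-1)%:E) ?ltry//.
by rewrite -integral_expRN; apply: eq_integral => x _ /=; rewrite gtr0_norm// expR_gt0.
Qed.

Let cn : continuous (fun x : R => expR (- e * `|x|)).
Proof. by move=> x; apply: (@continuous_comp _ _ _ (fun x : R => `|x|) (fun x => expR (- e * x))); [exact: (@norm_continuous _ R^o)|exact: ce]. Qed.

Lemma integral_expRN_norm : (\int[mu]_x (expR (- e * `|x|))%:E = (2 * e^-1)%:E)%E.
Proof.
rewrite ge0_even_integral//; last by move=> x /=; rewrite normrN.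
rewrite (_ : (\int[_]_(x in _) _)%E = (e^-1)%:E) ?EFinM//.
rewrite -integral_expRN; apply: eq_integral => x /[!inE]/= /[!in_itv]/= /andP[x0 _].
by rewrite gtr0_norm.
Qed.

Lemma integrable_expRN_norm : mu.-integrable setT (EFin \o (fun x : R => expR (- e * `|x|))).
Proof.
apply/integrableP; split.
  by apply/measurable_EFinP; exact: continuous_measurable_fun.
rewrite (_ : (\int[_]_(x in _) _)%E = (2 * e^-1)%:E) ?ltry//.
by rewrite -integral_expRN_norm; apply: eq_integral => x _ /=; rewrite gtr0_norm// expR_gt0.
Qed.

Let icos : mu.-integrable (`]0, +oo[ : set R) (EFin \o (fun x => expR (- e * x) * cos (L * x))).
Proof.
apply: (le_integrableR _ _ integrable_expRN) => //.
  apply: measurable_funTS; apply: continuous_measurable_fun => x.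
  by apply: cvgM; [exact: ce|exact: ccos].
move=> x _; rewrite normrM gtr0_norm ?expR_gt0// ler_piMr ?expR_ge0//.
by rewrite ler_norml cos_geN1 cos_le1.
Qed.

Lemma integral_expRN_cos : \int[mu]_(x in `]0, +oo[) (expR (- e * x) * cos (L * x)) =
  e / (e ^+ 2 + L ^+ 2).
Proof.
have D0 : 0 < e ^+ 2 + L ^+ 2 by rewrite ltr_pwDl ?exprn_gt0// sqr_ge0.
(* This is the real part of e^((-e + i L) x) / (-e + i L). *)
pose F (x : R) : R := expR (- e * x) * ((e ^+ 2 + L ^+ 2)^-1 * (L * sin (L * x) - e * cos (L * x))).
have cF : continuous F.
  move=> x; apply: cvgM; first exact: ce.
  apply: cvgM; first exact: cvg_cst.
  by apply: cvgB; apply: cvgM; [exact: cvg_cst|exact: csin|exact: cvg_cst|exact: ccos].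
have dc x : is_derive x (1 : R) (fun x => cos (L * x)) (- (L * sin (L * x))).
  apply: (eq_is_derive (is_derive1_comp (is_derive_cos (L * x))
    (is_deriveZ L (is_derive_id x 1)))) => //.
  by rewrite /GRing.scale /= mulr1 mulNr mulrC.
have ds x : is_derive x (1 : R) (fun x => sin (L * x)) (L * cos (L * x)).
  apply: (eq_is_derive (is_derive1_comp (is_derive_sin (L * x))
    (is_deriveZ L (is_derive_id x 1)))) => //.
  by rewrite /GRing.scale /= mulr1 mulrC.
have dF (x : R) : 0 < x -> is_derive x (1 : R) F (expR (- e * x) * cos (L * x)).
  move=> _.
  apply: (eq_is_derive (is_deriveM (is_derive_expRM (- e) x)
    (is_deriveZ (e ^+ 2 + L ^+ 2)^-1 (is_deriveB (is_deriveZ L (ds x)) (is_deriveZ e (dc x)))))) => //.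
  rewrite -[LHS]/(expR (- e * x) * ((e ^+ 2 + L ^+ 2)^-1 * (L * (L * cos (L * x)) -
      e * - (L * sin (L * x)))) + (e ^+ 2 + L ^+ 2)^-1 * (L * sin (L * x) -
      e * cos (L * x)) * (- e * expR (- e * x))).
  field; exact: lt0r_neq0.
have cf (x : R) : 0 < x -> {for x, continuous (fun x => expR (- e * x) * cos (L * x))}.
  by move=> _; apply: cvgM; [exact: ce|exact: ccos].
have F0 : F x @[x --> 0^'+] --> - (e / (e ^+ 2 + L ^+ 2)).
  apply: cvg_at_right_filter; have := cF 0.
  rewrite /continuous_at {2}/F !mulr0 expR0 sin0 cos0 mulr0 mul1r mulr1 sub0r mulrN.
  by rewrite (mulrC _ e).
have Foo : F x @[x --> +oo] --> 0.
  have B x : `|(e ^+ 2 + L ^+ 2)^-1 * (L * sin (L * x) - e * cos (L * x))| <=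
      (e ^+ 2 + L ^+ 2)^-1 * (`|L| + e).
    rewrite normrM gtr0_norm ?invr_gt0// ler_wpM2l ?invr_ge0 ?(ltW D0)//.
    rewrite (le_trans (ler_normB _ _))// !normrM (gtr0_norm e0) lerD//.
      by rewrite ler_piMr// ler_norml sin_geN1 sin_le1.
    by rewrite ler_piMr ?(ltW e0)// ler_norml cos_geN1 cos_le1.
  have C : (fun x : R => expR (- e * x) * ((e ^+ 2 + L ^+ 2)^-1 * (`|L| + e))) @ +oo --> (0 : R).
    rewrite -(mul0r ((e ^+ 2 + L ^+ 2)^-1 * (`|L| + e))).
    by apply: cvgM; [exact: cvgy_expRN|exact: cvg_cst].
  apply: (cvg0_dominated _ C); near=> x.
  by rewrite normrM gtr0_norm ?expR_gt0// ler_wpM2l ?expR_ge0.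
by rewrite (halfline_FTC dF cf F0 Foo icos) sub0r opprK.
Unshelve. all: by end_near. Qed.

(** The Fourier transform of the Abel factor: as a function of [L] it has total mass 2 pi and
    concentrates at 0 when [e] tends to 0. *)
Lemma poisson_kernel :
  cintegral setT (fun y : R => cis (y * L) * (expR (- e * `|y|))%:C) =
  (2 * e / (e ^+ 2 + L ^+ 2))%:C.
Proof.
have ic : mu.-integrable setT (EFin \o (fun x : R => expR (- e * `|x|) * cos (L * x))).
  apply: (le_integrableR _ _ integrable_expRN_norm) => //.
    by apply: continuous_measurable_fun => x; apply: cvgM; [exact: cn|exact: ccos].
  move=> x _; rewrite normrM gtr0_norm ?expR_gt0// ler_piMr ?expR_ge0//.
  by rewrite ler_norml cos_geN1 cos_le1.
apply: complex_eqP => /=.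
  under eq_Rintegral do rewrite mulr0 subr0 mulrC (mulrC _ L).
  (* Adding 1 to the cosine makes the integrand nonnegative, so that evenness can be used through
     [ge0_even_integral]; the contribution of the 1 is subtracted at the end. *)
  pose f (y : R) := expR (- e * `|y|) * (1 + cos (L * y)).
  have f0 y : 0 <= f y.
    by rewrite mulr_ge0 ?expR_ge0//; have := cos_geN1 (L * y); lra.
  have cf : continuous f.
    move=> x; apply: cvgM; first exact: cn.
    by apply: cvgD; [exact: cvg_cst|exact: ccos].
  have fe y : f (- y) = f y by rewrite /f normrN mulrN cosN.
  have E1 : \int[mu]_y f y = 2 * (e^-1 + e / (e ^+ 2 + L ^+ 2)).
    rewrite /Rintegral ge0_even_integral//.
    have -> : (\int[mu]_(x in `]0%R, +oo[) (f x)%:E)%E =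
       (e^-1 + e / (e ^+ 2 + L ^+ 2))%:E; last by [].
    rewrite EFinD -integral_expRN -integral_expRN_cos /Rintegral fineK; last first.
      by apply: integrable_fin_num => //; exact: icos.
    rewrite -integralD//; last exact: integrable_expRN.
    apply: eq_integral => x /[!inE]/= /[!in_itv]/= /andP[x0 _].
    by rewrite /f gtr0_norm// mulrDr mulr1.
  have : \int[mu]_y f y = \int[mu]_y expR (- e * `|y|) +
      \int[mu]_y (expR (- e * `|y|) * cos (L * y)).
    rewrite -RintegralD//; last exact: integrable_expRN_norm.
    by apply: eq_Rintegral => x _; rewrite /f mulrDr mulr1.
  rewrite E1 {1}/Rintegral integral_expRN_norm /= mulrDr => /addrI <-.
  by rewrite mulrA.
under eq_Rintegral do rewrite mulr0 add0r mulrC (mulrC _ L).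
set I := Rintegral _ _ _.
have : I = - I.
  rewrite {1}/I -integral_opp.
    rewrite -[RHS]mulN1r /I -RintegralZl//.
      by apply: eq_Rintegral => x _; rewrite normrN mulrN sinN; ring.
    apply: (le_integrableR _ _ integrable_expRN_norm) => //.
      by apply: continuous_measurable_fun => x; apply: cvgM; [exact: cn|exact: csin].
    move=> x _; rewrite normrM gtr0_norm ?expR_gt0// ler_piMr ?expR_ge0//.
    by rewrite ler_norml sin_geN1 sin_le1.
  apply: (le_integrableR _ _ integrable_expRN_norm) => //.
    by apply: continuous_measurable_fun => x; apply: cvgM; [exact: cn|exact: csin].
  move=> x _; rewrite normrM gtr0_norm ?expR_gt0// ler_piMr ?expR_ge0//.
  by rewrite ler_norml sin_geN1 sin_le1.
by move=> ?; lra.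
Qed.

End Poisson.

(** * The Gamma function on vertical lines *)

(** For x > 0 this is x^(c - 1) e^(-x), written as one exponential so that powers combine by [expRD]
    and [ring]. *)
Definition gamma_kernel (R : realType) (c x : R) : R := expR ((c - 1) * ln x - x).

Lemma gamma_kernel_ge0 (R : realType) (c x : R) : 0 <= gamma_kernel c x.
Proof. exact: expR_ge0. Qed.

Lemma gamma_kernelS (R : realType) (c x : R) : 0 < x ->
  gamma_kernel (c + 1) x = x * gamma_kernel c x.
Proof.
move=> x0; rewrite /gamma_kernel -{3}(lnK x0) -expRD; congr expR; ring.
Qed.

(** The left side peaks at [x = c]; this is [1 + t <= expR t] at [t = ln x - ln c], multiplied by
    [c]. *)
Lemma mulr_lnB_le (R : realType) (c x : R) : 0 < c -> 0 < x ->
  c * ln x - x <= c * ln c - c.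
Proof.
move=> c0 x0.
have := expR_ge1Dx (ln x - ln c).
rewrite expRB !lnK ?posrE// => h.
have : c * (1 + (ln x - ln c)) <= x.
  by rewrite -ler_pdivlMl// mulrC.
lra.
Qed.

Lemma continuous_gamma_kernel (R : realType) (c x : R) : 0 < x ->
  {for x, continuous (gamma_kernel c)}.
Proof.
move=> x0; apply: (@continuous_comp _ _ _ (fun x => (c - 1) * ln x - x)); last exact: continuous_expR.
apply: cvgB; last exact: cvg_id.
by apply: cvgM; [exact: cvg_cst|exact: continuous_ln].
Qed.

Lemma is_derive_gamma_kernel (R : realType) (c x : R) : 0 < x ->
  is_derive x (1 : R) (gamma_kernel (c + 1)) (c * gamma_kernel c x - gamma_kernel (c + 1) x).
Proof.
move=> x0.
have dl : is_derive x (1 : R) (fun x => (c + 1 - 1) * ln x - x) ((c + 1 - 1) * x^-1 - 1).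
  apply: (eq_is_derive (is_deriveB (is_deriveZ (c + 1 - 1) (is_derive1_ln x0))
    (is_derive_id x (1 : R)))) => //.
apply: (eq_is_derive (is_derive_comp (@is_derive_expR R) dl)) => //.
rewrite -[LHS]/(gamma_kernel (c + 1) x * ((c + 1 - 1) * x^-1 - 1)).
rewrite gamma_kernelS//; field; exact: lt0r_neq0.
Qed.

Lemma integrable_gamma_kernel (R : realType) (c : R) : 0 < c ->
  (@lebesgue_measure R).-integrable (`]0, +oo[ : set R) (EFin \o gamma_kernel c).
Proof.
move=> c0.
(* a logistic function of [c * ln x] has an integrable derivative that dominates the kernel *)
pose E (x : R) : R := expR (c * ln x).
have E0 x : 0 < E x by exact: expR_gt0.
have cE (x : R) : 0 < x -> {for x, continuous E}.
  move=> x0; apply: (@continuous_comp _ _ _ (fun x => c * ln x)); last exact: continuous_expR.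
  by apply: cvgM; [exact: cvg_cst|exact: continuous_ln].
have D0 x : 0 < 1 + E x by rewrite addr_gt0.
pose F (x : R) : R := - (1 + E x)^-1.
pose f (x : R) : R := c * E x / x / (1 + E x) ^+ 2.
have dF (x : R) : 0 < x -> is_derive x (1 : R) F (f x).
  move=> x0.
  have dE : is_derive x (1 : R) (fun x => 1 + E x) (c * E x / x).
    have dl : is_derive x (1 : R) (fun x => c * ln x) (c * x^-1).
      exact: (eq_is_derive (is_deriveZ c (is_derive1_ln x0))).
    apply: (eq_is_derive (is_deriveD (is_derive_cst (1 : R) x (1 : R))
      (is_derive_comp (@is_derive_expR R) dl))) => //.
    rewrite -[LHS]/(0 + E x * (c * x^-1)); ring.
  have dV := @is_deriveV _ (fun x => 1 + E x) x _ _ (lt0r_neq0 (D0 x)) dE.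
  apply: (eq_is_derive (is_deriveN dV)) => //.
  rewrite -[LHS]/(- (- (1 + E x) ^- 2 * (c * E x / x))) /f.
  field; rewrite lt0r_neq0//; exact: lt0r_neq0.
have cf (x : R) : 0 < x -> {for x, continuous f}.
  move=> x0; apply: cvgM.
    apply: cvgM; first by apply: cvgM; [exact: cvg_cst|exact: cE].
    by apply: inv_continuous; rewrite gt_eqF.
  apply: cvgV; first by rewrite lt0r_neq0// exprn_gt0.
  by rewrite /continuous_at !expr2; apply: cvgM;
    apply: cvgD; [exact: cvg_cst|exact: cE|exact: cvg_cst|exact: cE].
have F0 : F x @[x --> 0^'+] --> - (1 : R).
  have h : E x @[x --> 0^'+] --> (0 : R).
    apply: cvg_trans (powR_cvg0 c0); apply: near_eq_cvg; near=> x.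
    have x0 : 0 < x by [].
    by rewrite /E /powR gt_eqF.
  apply: cvgN; rewrite -[X in _ --> X]invr1; apply: cvgV; first exact: oner_neq0.
  by rewrite -[X in _ --> X]addr0; apply: cvgD => //; exact: cvg_cst.
have Foo : F x @[x --> +oo] --> (0 : R).
  rewrite -[X in _ --> X]oppr0; apply: cvgN.
  apply: (@cvg_comp _ _ _ (fun x => 1 + E x) (fun y => y^-1) _ +oo); last exact: cvgy_inv.
  apply/cvgryPge => M; near=> x.
  have lx : M / c <= ln x by near: x; move: (M / c); exact/cvgryPge/cvgy_ln.
  rewrite (@le_trans _ _ (1 + c * ln x))//.
    by rewrite ler_pdivrMr// mulrC in lx; lra.
  by rewrite lerD2l; have := expR_ge1Dx (c * ln x); rewrite /E; lra.
have f0 (x : R) : 0 < x -> 0 <= f x.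
  move=> x0; rewrite /f !mulr_ge0// ?invr_ge0 ?exprn_ge0//; exact: ltW.
have intf := ge0_halfline_integrable dF cf F0 Foo f0.
(* From (1 + E)^2 <= 2 + 2 E^2, where e^(-x) is at most 1 and e^(-x) E^2 = x^(2c) e^(-x) is at most
   its value at x = 2c. *)
pose K : R := 2 + 2 * expR (2 * c * ln (2 * c) - 2 * c).
have K0 : 0 < K by rewrite addr_gt0// mulr_gt0// expR_gt0.
have intKf := integrableZlR (K / c) (measurable_itv `]0, +oo[) intf.
apply: (le_integrableR _ _ intKf) => //.
  apply: open_continuous_measurable_fun; first exact: interval_open.
  by move=> x; rewrite inE/= in_itv/= andbT; exact: continuous_gamma_kernel.
move=> x /=; rewrite in_itv/= andbT => x0.
rewrite ger0_norm ?gamma_kernel_ge0//.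
have gE : gamma_kernel c x = E x * expR (- x) / x.
  rewrite -[RHS]/(E x * expR (- x) * x^-1) /E -[X in X^-1](lnK x0) -expRN -!expRD.
  by congr expR; ring.
have -> : K / c * f x = E x / x * (K / (1 + E x) ^+ 2).
  rewrite /f; field; rewrite lt0r_neq0// lt0r_neq0//= lt0r_neq0//.
rewrite gE mulrAC ler_wpM2l//; first by rewrite divr_ge0// ltW.
rewrite ler_pdivlMr ?exprn_gt0//.
have B : expR (- x) * E x ^+ 2 <= expR (2 * c * ln (2 * c) - 2 * c).
  rewrite expr2 /E -!expRD ler_expR.
  have -> : - x + (c * ln x + c * ln x) = 2 * c * ln x - x by ring.
  by rewrite mulr_lnB_le// mulr_gt0.
have e1 : expR (- x) <= 1 by rewrite -expR0 ler_expR oppr_le0 ltW.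
have : (1 + E x) ^+ 2 <= 2 + 2 * E x ^+ 2 by have := sqr_ge0 (1 - E x); nra.
move=> /(ler_wpM2l (expR_ge0 (- x))) h; apply: (le_trans h).
rewrite mulrDr /K; lra.
Unshelve. all: by end_near. Qed.

(** Only the phase depends on [y]: this is the shape to which [phase_Fubini] applies, with [L] equal
    to [ln]. *)
Lemma cGammaE (R : realType) (c y : R) :
  cGamma (c +i* y) = cintegral `]0, +oo[ (fun w => cis (y * ln w) * (gamma_kernel c w)%:C).
Proof.
apply: eq_cintegral => x /=; rewrite in_itv/= andbT => x0.
have -> : (c +i* y) - 1 = (c - 1) +i* y by apply: complex_eqP => //=; rewrite subr0.
rewrite cpowE mulrAC mulrC (mulrC y); congr (_ * _).
by rewrite -rmorphM -expRD mulrC.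
Qed.

Lemma cintegrable_gamma (R : realType) (c : R) : 0 < c ->
  cintegrable `]0, +oo[ (fun w : R => (gamma_kernel c w)%:C).
Proof. by move=> c0; apply: cintegrable_real => //; exact: integrable_gamma_kernel. Qed.

Lemma cGamma_measurable (R : realType) (c : R) : 0 < c ->
  measurable_fun setT (fun y : R => complex.Re (cGamma (c +i* y))) /\
  measurable_fun setT (fun y : R => complex.Im (cGamma (c +i* y))).
Proof.
move=> c0.
have [m1 m2] := phase_measurable (@measurable_ln R) (measurable_itv `]0, +oo[) (cintegrable_gamma c0).
by split; under eq_fun do rewrite cGammaE.
Qed.

Lemma norm1_cGamma (R : realType) (c : R) : 0 < c ->
  exists2 K : R, 0 < K & forall y : R, norm1 (cGamma (c +i* y)) <= K.
Proof.
move=> c0.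
pose I := \int[lebesgue_measure]_(w in `]0, +oo[) (2 * gamma_kernel c w).
have I0 : 0 <= I by apply: Rintegral_ge0 => w _; rewrite mulr_ge0// gamma_kernel_ge0.
exists (2 * I + 1) => [|y]; first by lra.
rewrite cGammaE (le_trans (@norm1_cintegral _ _ _ (fun w => 2 * gamma_kernel c w) _ _ _ _))//.
- exact: (cintegrable_phase_r (@measurable_ln R) _ (cintegrable_gamma c0)).
- by apply: integrableZlR => //; exact: integrable_gamma_kernel.
- move=> w _; rewrite (le_trans (norm1M _ _))// norm1_real ger0_norm ?gamma_kernel_ge0//.
  by rewrite ler_wpM2r ?gamma_kernel_ge0// norm1_cis.
- by rewrite lerDl.
Qed.

(** Integration by parts: the function h(y ln w) w^c e^(-w) vanishes at both ends of the half-line,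
    so its derivative integrates to 0. The cosine and the sine as [h] give the two parts of Gamma(z
    + 1) = z Gamma(z). *)
Lemma gamma_kernel_parts (R : realType) (c y : R) (h h' : R -> R) : 0 < c ->
  (forall t, is_derive t (1 : R) h (h' t)) -> continuous h' ->
  (forall t, `|h t| <= 1) -> (forall t, `|h' t| <= 1) ->
  let mu := @lebesgue_measure R in
  c * \int[mu]_(w in `]0, +oo[) (h (y * ln w) * gamma_kernel c w) +
  y * \int[mu]_(w in `]0, +oo[) (h' (y * ln w) * gamma_kernel c w) =
  \int[mu]_(w in `]0, +oo[) (h (y * ln w) * gamma_kernel (c + 1) w).
Proof.
move=> c0 dh ch' h1 h'1 mu.
have ch : continuous h.
  by move=> x; apply: differentiable_continuous; apply/derivable1_diffP; have [] := dh x.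
have cl (w : R) : 0 < w -> {for w, continuous (fun w => y * ln w)}.
  by move=> w0; apply: cvgM; [exact: cvg_cst|exact: continuous_ln].
have cg (g : R -> R) : continuous g -> forall w : R, 0 < w ->
    {for w, continuous (fun w => g (y * ln w))}.
  move=> cg w w0; apply: (@continuous_comp _ _ _ (fun w => y * ln w)); [exact: cl|exact: cg].
have ig (g : R -> R) (b : R) : 0 < b -> continuous g -> (forall t, `|g t| <= 1) ->
    mu.-integrable (`]0, +oo[ : set R) (EFin \o (fun w => g (y * ln w) * gamma_kernel b w)).
  move=> b0 cg' g1; apply: (le_integrableR _ _ (integrable_gamma_kernel b0)) => //.
    apply: open_continuous_measurable_fun; first exact: interval_open.
    move=> w; rewrite inE/= in_itv/= andbT => w0.
    by apply: cvgM; [exact: cg|exact: continuous_gamma_kernel].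
  move=> w _; rewrite normrM (ger0_norm (gamma_kernel_ge0 _ _)) ler_piMl// gamma_kernel_ge0//.
have c10 : 0 < c + 1 by rewrite addr_gt0.
pose F (w : R) : R := h (y * ln w) * gamma_kernel (c + 1) w.
pose f (w : R) : R := c * (h (y * ln w) * gamma_kernel c w) +
  y * (h' (y * ln w) * gamma_kernel c w) - h (y * ln w) * gamma_kernel (c + 1) w.
have dF (w : R) : 0 < w -> is_derive w (1 : R) F (f w).
  move=> w0.
  have dl : is_derive w (1 : R) (fun w => y * ln w) (y * w^-1).
    exact: (eq_is_derive (is_deriveZ y (is_derive1_ln w0))).
  apply: (eq_is_derive (is_deriveM (is_derive_comp dh dl) (is_derive_gamma_kernel c w0))) => //.
  rewrite -[LHS]/(h (y * ln w) * (c * gamma_kernel c w - gamma_kernel (c + 1) w) +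
    gamma_kernel (c + 1) w * (h' (y * ln w) * (y * w^-1))) /f gamma_kernelS//.
  field; exact: lt0r_neq0.
have cf (w : R) : 0 < w -> {for w, continuous f}.
  move=> w0; have k1 := cg _ ch _ w0; have k2 := cg _ ch' _ w0.
  have k3 := @continuous_gamma_kernel _ c _ w0; have k4 := @continuous_gamma_kernel _ (c + 1) _ w0.
  apply: cvgB; last by apply: cvgM; [exact: k1|exact: k4].
  by apply: cvgD; apply: cvgM; [exact: cvg_cst|apply: cvgM; [exact: k1|exact: k3]|
    exact: cvg_cst|apply: cvgM; [exact: k2|exact: k3]].
have Fb (w : R) : `|F w| <= gamma_kernel (c + 1) w.
  by rewrite normrM (ger0_norm (gamma_kernel_ge0 _ _)) ler_piMl// gamma_kernel_ge0.
have F0 : F w @[w --> 0^'+] --> (0 : R).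
  have p0 : w `^ c @[w --> 0^'+] --> (0 : R) by exact: powR_cvg0.
  apply: (cvg0_dominated _ p0); near=> w.
  have w0 : 0 < w by [].
  rewrite (le_trans (Fb w))// /gamma_kernel /powR gt_eqF// ler_expR addrK.
  by rewrite gerBl ltW.
have Foo : F w @[w --> +oo] --> (0 : R).
  (* [K] is the maximum of w^(c + 1) e^(-w), that is, of w times the kernel; hence the kernel is at
     most [K / w]. *)
  pose K : R := expR ((c + 1) * ln (c + 1) - (c + 1)).
  have p0 : (fun w : R => K * w^-1) @ +oo --> (0 : R).
    by rewrite -(mulr0 K); apply: cvgM; [exact: cvg_cst|exact: cvgy_inv].
  apply: (cvg0_dominated _ p0); near=> w.
  have w0 : 0 < w by [].
  rewrite (le_trans (Fb w))// ler_pdivlMr// mulrC -gamma_kernelS//.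
  rewrite /gamma_kernel addrK ler_expR; exact: mulr_lnB_le.
have i1 := ig h c c0 ch h1.
have i2 := ig h' c c0 ch' h'1.
have i3 := ig h (c + 1) c10 ch h1.
have mD : measurable (`]0, +oo[ : set R) by [].
have i1' := integrableZlR c mD i1.
have i2' := integrableZlR y mD i2.
have i12 : mu.-integrable (`]0, +oo[ : set R) (EFin \o (fun w => c * (h (y * ln w) * gamma_kernel c w) +
    y * (h' (y * ln w) * gamma_kernel c w))).
  have := integrableD _ i1' i2'; apply => //.
have intf : mu.-integrable (`]0, +oo[ : set R) (EFin \o f).
  have := integrableB _ i12 i3; apply => //.
have := halfline_FTC dF cf F0 Foo intf.
rewrite subr0 RintegralB// RintegralD// !RintegralZl// => /eqP.
by rewrite subr_eq0 => /eqP.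
Unshelve. all: by end_near. Qed.

Lemma cGammaS (R : realType) (c y : R) : 0 < c ->
  (c +i* y) * cGamma (c +i* y) = cGamma ((c + 1) +i* y).
Proof.
move=> c0; rewrite !cGammaE /cintegral.
have E (b : R) :
  cintegral `]0, +oo[ (fun w => cis (y * ln w) * (gamma_kernel b w)%:C) =
  (\int[lebesgue_measure]_(w in `]0, +oo[) (cos (y * ln w) * gamma_kernel b w)) +i*
  (\int[lebesgue_measure]_(w in `]0, +oo[) (sin (y * ln w) * gamma_kernel b w)).
  rewrite /cintegral; apply: complex_eqP; apply: eq_Rintegral => w _.
    by rewrite ReM /= mulr0 subr0.
  by rewrite ImM /= mulr0 add0r.
rewrite -/(cintegral _ _) E -/(cintegral _ _) E.
have cNs : continuous (fun t : R => - sin t) by move=> x; apply: cvgN; exact: continuous_sin.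
(* The choice h = cos yields the real part of the recursion and h = sin the imaginary part. *)
have hc := @gamma_kernel_parts R c y cos (fun t => - sin t) c0 (@is_derive_cos R) cNs.
have hs := @gamma_kernel_parts R c y sin cos c0 (@is_derive_sin R) (@continuous_cos R).
have s1 (t : R) : `|sin t| <= 1 by rewrite ler_norml sin_geN1 sin_le1.
have c1 (t : R) : `|cos t| <= 1 by rewrite ler_norml cos_geN1 cos_le1.
have s1' (t : R) : `|- sin t| <= 1 by rewrite normrN.
apply: complex_eqP; rewrite ?ReM ?ImM /=.
  rewrite -(hc c1 s1'); congr (_ + _); rewrite -mulrN; congr (_ * _).
  rewrite -mulN1r -RintegralZl//; first by apply: eq_Rintegral => w _; ring.
  apply: (le_integrableR _ _ (integrable_gamma_kernel c0)) => //.
    apply: measurable_funM.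
      apply: measurableT_comp; first by apply: continuous_measurable_fun; exact: continuous_sin.
      by apply: measurable_funM => //; apply: measurable_funTS; exact: measurable_ln.
    exact: integrable_measurable_fun (integrable_gamma_kernel c0).
  move=> w _; rewrite normrM (ger0_norm (gamma_kernel_ge0 _ _)) ler_piMl// gamma_kernel_ge0//.
by rewrite -(hs s1 c1).
Qed.

Lemma norm1_invc (R : realType) (a b : R) : 0 < a ->
  norm1 ((a +i* b)^-1) = (a + `|b|) / (a ^+ 2 + b ^+ 2).
Proof.
move=> a0; have D0 : 0 < a ^+ 2 + b ^+ 2 by rewrite ltr_pwDl ?exprn_gt0// sqr_ge0.
have -> : (a +i* b)^-1 = (a / (a ^+ 2 + b ^+ 2)) +i* (- b / (a ^+ 2 + b ^+ 2)).
  by apply: complex_eqP => //=; rewrite mulNr.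
by rewrite /norm1 /= !normrM normrN (gtr0_norm a0) gtr0_norm ?invr_gt0// mulrDl.
Qed.

Lemma norm1_cGamma_decay (R : realType) (c : R) : 0 < c ->
  exists2 K : R, 0 < K & forall y : R, norm1 (cGamma (c +i* y)) <= K * (1 + y ^+ 2)^-1.
Proof.
move=> c0; have [K K0 hK] := @norm1_cGamma R (c + 1 + 1) ltac:(lra).
have c2 : 0 < c ^- 2 by rewrite invr_gt0 exprn_gt0.
exists (2 * (1 + c ^- 2) * K); first by rewrite !mulr_gt0// addr_gt0.
move=> y.
have nz (a : R) : 0 < a -> a +i* y != 0.
  by move=> a0; rewrite eq_complex /= negb_and lt0r_neq0.
have E : cGamma (c +i* y) = (c +i* y)^-1 * ((c + 1) +i* y)^-1 * cGamma ((c + 1 + 1) +i* y).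
  rewrite -cGammaS; last by lra.
  by rewrite -cGammaS// -mulrA !mulKf ?nz//; lra.
have c1 : 0 < c + 1 by lra.
rewrite E (le_trans (norm1M _ _))//.
(* The intermediate bound has c^2 + y^2 in its denominator; the factor 1 + c^(-2) pays for replacing
   this by 1 + y^2. *)
rewrite (@le_trans _ _ (2 * (c ^+ 2 + y ^+ 2)^-1 * K))//.
  apply: ler_pM; rewrite ?norm1_ge0//.
  rewrite (le_trans (norm1M _ _))// !norm1_invc//.
  have D0 : 0 < c ^+ 2 + y ^+ 2 by rewrite ltr_pwDl ?exprn_gt0// sqr_ge0.
  have D1 : 0 < (c + 1) ^+ 2 + y ^+ 2 by rewrite ltr_pwDl ?exprn_gt0// sqr_ge0.
  rewrite mulrACA -invfM (mulrC _ ((c + 1) ^+ 2 + y ^+ 2)) invfM mulrA ler_wpM2r ?invr_ge0 ?(ltW D0)//.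
  rewrite ler_pdivrMr//.
  have ny : y ^+ 2 = `|y| ^+ 2 by rewrite real_normK ?num_real.
  (* The right side minus the left side is (|y| - c - 1/2)^2 + 2 c + 7/4. *)
  rewrite ny; have := normr_ge0 y; have := sqr_ge0 (`|y| - c - 2^-1); nra.
have -> : 2 / (c ^+ 2 + y ^+ 2) * K = 2 * K * (c ^+ 2 + y ^+ 2)^-1 by ring.
have -> : 2 * (1 + c ^- 2) * K / (1 + y ^+ 2) = 2 * K * ((1 + c ^- 2) / (1 + y ^+ 2)) by ring.
rewrite ler_wpM2l//; first by rewrite mulr_ge0// ltW.
have D0 : 0 < c ^+ 2 + y ^+ 2 by rewrite ltr_pwDl ?exprn_gt0// sqr_ge0.
have D1 : 0 < 1 + y ^+ 2 by rewrite ltr_pwDl// sqr_ge0.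
rewrite ler_pdivlMr// mulrC ler_pdivrMr//.
have -> : (1 + c ^- 2) * (c ^+ 2 + y ^+ 2) = 1 + y ^+ 2 + (c ^+ 2 + c ^- 2 * y ^+ 2).
  field; exact: lt0r_neq0.
by rewrite lerDl addr_ge0 ?sqr_ge0// mulr_ge0 ?sqr_ge0 ?(ltW c2).
Qed.

Lemma cintegrable_cGamma (R : realType) (c : R) : 0 < c ->
  cintegrable setT (fun y : R => cGamma (c +i* y)).
Proof.
move=> c0; have [K K0 hK] := norm1_cGamma_decay c0; have [m1 m2] := cGamma_measurable c0.
apply: (@le_cintegrable _ _ _ (fun y => K * (1 + y ^+ 2)^-1)) => //.
by apply: integrableZlR => //; exact: integrable_oneDsqrV.
Qed.

(** * The Cahen-Mellin inversion formula *)

Lemma Rintegral_dominated_cvg (R : realType) (D : set R) (f_ : nat -> R -> R) (f g : R -> R) :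
  let mu := @lebesgue_measure R in measurable D ->
  (forall n, measurable_fun D (f_ n)) ->
  (forall x, D x -> (fun n => f_ n x) @ \oo --> f x) ->
  mu.-integrable D (EFin \o g) -> (forall n x, D x -> `|f_ n x| <= g x) ->
  (fun n => \int[mu]_(x in D) f_ n x) @ \oo --> \int[mu]_(x in D) f x.
Proof.
move=> mu mD mf fcvg ig fg.
have mf' n : measurable_fun D (EFin \o f_ n) by apply/measurable_EFinP.
have cf' x : D x -> (fun n => (f_ n x)%:E) @ \oo --> (f x)%:E.
  by move=> Dx; apply: cvg_EFin; [exact: nearW|exact: fcvg].
have mfl : measurable_fun D (EFin \o f).
  by apply: (emeasurable_fun_cvg (fun n => EFin \o f_ n)) => //.
have [iff _ C] : [/\ mu.-integrable D (EFin \o f),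
    [sequence \int[mu]_(x in D) `|(f_ n x)%:E - (f x)%:E|]_n @ \oo --> 0 &
    [sequence \int[mu]_(x in D) (f_ n x)%:E]_n @ \oo --> \int[mu]_(x in D) (f x)%:E]%E.
  apply: (@dominated_convergence _ _ _ mu D mD (fun n => EFin \o f_ n) (EFin \o f) (EFin \o g)) => //.
  - by apply: aeW => x Dx; exact: cf'.
  - by apply: aeW => x n Dx /=; rewrite lee_fin; exact: fg.
apply: fine_cvg; rewrite /Rintegral fineK//; exact: (integrable_fin_num _ iff).
Qed.

(** Limits as e tends to 0 are taken along e = 1 / (n + 1), since dominated convergence is about
    sequences. *)
Lemma cvg_harmonic_comp (R : realType) (h : R -> R) : {for 0, continuous h} ->
  (fun n => h (n.+1%:R^-1)) @ \oo --> h 0.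
Proof.
move=> ch; apply: (@cvg_comp _ _ _ (fun n : nat => n.+1%:R^-1) h _ (nbhs (0 : R))); last exact: ch.
exact: cvg_harmonic.
Qed.

Section CahenMellin.
Variables (R : realType) (c x : R).
Hypotheses (c0 : 0 < c) (x0 : 0 < x).
Let mu := @lebesgue_measure R.
Let psi (w : R) : R := expR (- c * ln x) * gamma_kernel c w.
Let G (y : R) : R[i] := cGamma (c +i* y) * cpow x (- (c +i* y)).
Let L (w : R) : R := ln w - ln x.
Let Phi (e y : R) : R[i] := (expR (- e * `|y|))%:C.

Let mL : measurable_fun setT L.
Proof. by apply: measurable_funB => //; exact: measurable_ln. Qed.

Let ipsi : cintegrable `]0, +oo[ (fun w => (psi w)%:C).
Proof. by apply: cintegrable_real => //; apply: integrableZlR => //; exact: integrable_gamma_kernel. Qed.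

Let GE y : G y = cintegral `]0, +oo[ (fun w => cis (y * L w) * (psi w)%:C).
Proof.
have -> : G y = ((expR (- c * ln x))%:C * cis (- y * ln x)) * cGamma (c +i* y).
  rewrite /G mulrC; congr (_ * _).
  have -> : - (c +i* y) = (- c) +i* (- y) by apply: complex_eqP.
  by rewrite cpowE ![ln x * _]mulrC.
rewrite cGammaE -cintegralZl//; last first.
  by apply: (cintegrable_phase_r (@measurable_ln R)) => //; exact: cintegrable_gamma.
apply: eq_cintegral => w _.
by rewrite /psi /L realCM mulrBr cisD (mulNr y); ring.
Qed.

Let iG : cintegrable setT G.
Proof.
apply: (@eq_cintegrable _ _ (fun y => cpow x (- (c +i* y)) * cGamma (c +i* y))) => //.
  by move=> y _; rewrite mulrC.
have E y : cpow x (- (c +i* y)) = (expR (ln x * - c))%:C * cis (ln x * - y).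
  by rewrite -cpowE; congr cpow; apply: complex_eqP.
have cl : continuous (fun y : R => ln x * - y).
  by move=> y; apply: cvgM; [exact: cvg_cst|apply: cvgN; exact: cvg_id].
apply: (@le_cintegrable_mulr _ _ _ _ (expR (ln x * - c) * 2)) => //.
- under eq_fun do rewrite E ReM /= mul0r subr0.
  apply: continuous_measurable_fun => y; apply: cvgM; first exact: cvg_cst.
  by apply: (@continuous_comp _ _ _ (fun y => ln x * - y)); [exact: cl|exact: continuous_cos].
- under eq_fun do rewrite E ImM /= mul0r addr0.
  apply: continuous_measurable_fun => y; apply: cvgM; first exact: cvg_cst.
  by apply: (@continuous_comp _ _ _ (fun y => ln x * - y)); [exact: cl|exact: continuous_sin].
- move=> y _; rewrite E (le_trans (norm1M _ _))// norm1_real gtr0_norm ?expR_gt0//.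
  by rewrite ler_wpM2l ?expR_ge0// norm1_cis.
- exact: cintegrable_cGamma.
Qed.

Let iPhi e : 0 < e -> cintegrable setT (Phi e).
Proof. by move=> e0; apply: cintegrable_real => //; exact: integrable_expRN_norm. Qed.

(** The integrand against the Poisson kernel after the substitution w = x e^(e u): the width [e] of
    the kernel is absorbed, and [e] is left only in a factor that tends to e^(-x). *)
Let A (e u : R) : R := expR (c * (e * u) - x * expR (e * u)) * (2 * (1 + u ^+ 2)^-1).

Let cA e : continuous (A e).
Proof.
move=> u; apply: cvgM; last first.
  by apply: cvgM; [exact: cvg_cst|exact: continuous_oneDsqrV].
have ce : {for u, continuous (fun u : R => e * u)} by exact: mulrl_continuous.
apply: (@continuous_comp _ _ _ (fun u => c * (e * u) - x * expR (e * u))); last exact: continuous_expR.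
apply: cvgB; first by apply: cvgM; [exact: cvg_cst|exact: ce].
apply: cvgM; first exact: cvg_cst.
by apply: (@continuous_comp _ _ _ (fun u => e * u)); [exact: ce|exact: continuous_expR].
Qed.

Let regularized e : 0 < e ->
  cintegral setT (fun y => Phi e y * G y) = (\int[mu]_u A e u)%:C.
Proof.
move=> e0.
under eq_cintegral do rewrite GE.
rewrite (phase_Fubini mL _ (iPhi e0) ipsi)//.
under eq_cintegral do rewrite poisson_kernel// -realCM.
rewrite cintegral_real; congr (_%:C); rewrite /Rintegral; congr fine.
pose H (v : R) : R := expR (c * (v - ln x) - expR v) * (2 * e / (e ^+ 2 + (v - ln x) ^+ 2)).
have D0 (v : R) : 0 < e ^+ 2 + (v - ln x) ^+ 2 by rewrite ltr_pwDl ?exprn_gt0// sqr_ge0.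
have H0 v : 0 <= H v by rewrite mulr_ge0 ?expR_ge0// divr_ge0 ?(ltW (D0 v))// mulr_ge0// ltW.
have cH : continuous H.
  move=> v.
  have cs : {for v, continuous (fun v : R => v - ln x)} by apply: cvgB; [exact: cvg_id|exact: cvg_cst].
  apply: cvgM.
    apply: (@continuous_comp _ _ _ (fun v => c * (v - ln x) - expR v)); last exact: continuous_expR.
    by apply: cvgB; [apply: cvgM; [exact: cvg_cst|exact: cs]|exact: continuous_expR].
  apply: cvgM; first exact: cvg_cst.
  apply: cvgV; first by rewrite lt0r_neq0.
  apply: cvgD; first exact: cvg_cst.
  by under eq_fun do rewrite expr2; rewrite expr2; apply: cvgM; exact: cs.
transitivity (\int[mu]_(w in `]0%R, +oo[) (H (ln w) / w)%:E)%E.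
  apply: eq_integral => w /[!inE]/= /[!in_itv]/= /andP[w0 _]; congr EFin.
  have iw : w^-1 = expR (- ln w) by rewrite expRN lnK.
  have -> : psi w = expR (c * (ln w - ln x) - w) / w.
    by rewrite /psi /gamma_kernel iw -!expRD; congr expR; ring.
  by rewrite /H /L lnK// mulrAC.
rewrite ge0_integral_ln_subst//.
rewrite (@ge0_integral_affine _ e (ln x)) ?lt0r_neq0//; last first.
  by apply/measurable_EFinP; exact: continuous_measurable_fun.
have mHc : measurable_fun setT (fun u : R => (H (e * u + ln x))%:E).
  apply/measurable_EFinP; apply: continuous_measurable_fun => u.
  apply: (@continuous_comp _ _ _ (fun u => e * u + ln x)); last exact: cH.
  by apply: cvgD; [exact: mulrl_continuous|exact: cvg_cst].
rewrite -ge0_integralZl//; last by move=> u _; rewrite lee_fin.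
apply: eq_integral => u _; rewrite -EFinM; congr EFin.
rewrite gtr0_norm// /H /A addrK (expRD (e * u)) lnK// (mulrC _ x) mulrCA; congr (_ * _).
have D1 : 0 < 1 + u ^+ 2 by rewrite ltr_pwDl// sqr_ge0.
have -> : e ^+ 2 + (e * u) ^+ 2 = e ^+ 2 * (1 + u ^+ 2) by ring.
by field; rewrite !lt0r_neq0.
Qed.

(** [mulr_lnB_le] at the point [x * expR (e * u)] bounds the exponent uniformly in [e] and [u]. *)
Let Abound e u : `|A e u| <= expR (c * ln c - c - c * ln x) * (2 * (1 + u ^+ 2)^-1).
Proof.
have D1 : 0 < 1 + u ^+ 2 by rewrite ltr_pwDl// sqr_ge0.
have P : 0 < 2 * (1 + u ^+ 2)^-1 by rewrite mulr_gt0// invr_gt0.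
rewrite gtr0_norm; last by rewrite mulr_gt0// expR_gt0.
rewrite ler_wpM2r ?(ltW P)// ler_expR.
have w0 : 0 < x * expR (e * u) by rewrite mulr_gt0// expR_gt0.
have := mulr_lnB_le c0 w0; rewrite lnM ?posrE ?expR_gt0// expRK; lra.
Qed.

Let cvgA : (fun n => \int[mu]_u A n.+1%:R^-1 u) @ \oo --> 2 * pi * expR (- x).
Proof.
have -> : 2 * pi * expR (- x) = \int[mu]_u (expR (- x) * (2 * (1 + u ^+ 2)^-1)).
  rewrite RintegralZl//; last by apply: integrableZlR => //; exact: integrable_oneDsqrV.
  rewrite RintegralZl//; last exact: integrable_oneDsqrV.
  by rewrite /Rintegral integral_oneDsqrV /=; ring.
apply: (@Rintegral_dominated_cvg _ _ (fun n => A n.+1%:R^-1) _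
  (fun u => expR (c * ln c - c - c * ln x) * (2 * (1 + u ^+ 2)^-1))) => //.
- by move=> n; exact: continuous_measurable_fun.
- move=> u _; apply: cvgM; last exact: cvg_cst.
  have -> : expR (- x) = expR (c * (0 * u) - x * expR (0 * u)).
    by rewrite mul0r mulr0 expR0 mulr1 sub0r.
  apply: (@cvg_harmonic_comp _ (fun e : R => expR (c * (e * u) - x * expR (e * u)))).
  have ce : {for 0, continuous (fun e : R => e * u)} by exact: mulrr_continuous.
  apply: (@continuous_comp _ _ _ (fun e : R => c * (e * u) - x * expR (e * u))); last exact: continuous_expR.
  apply: cvgB; first by apply: cvgM; [exact: cvg_cst|exact: ce].
  apply: cvgM; first exact: cvg_cst.
  by apply: (@continuous_comp _ _ _ (fun e : R => e * u)); [exact: ce|exact: continuous_expR].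
- by do 2 apply: integrableZlR => //; exact: integrable_oneDsqrV.
Qed.

Let cvgPhi (g : R -> R) : mu.-integrable setT (EFin \o g) ->
  (fun n => \int[mu]_y (expR (- n.+1%:R^-1 * `|y|) * g y)) @ \oo --> \int[mu]_y g y.
Proof.
move=> ig; apply: (@Rintegral_dominated_cvg _ _ (fun n y => expR (- n.+1%:R^-1 * `|y|) * g y) _
  (fun y => `|g y|)) => //.
- move=> n; apply: measurable_funM; last exact: integrable_measurable_fun.
  by have [] := cintegrable_measurable (@iPhi n.+1%:R^-1 ltac:(by rewrite invr_gt0)).
- move=> y _; rewrite -[X in _ --> X]mul1r; apply: cvgM; last exact: cvg_cst.
  have C0 : {for 0, continuous (fun e : R => expR (- e * `|y|))}.
    apply: (@continuous_comp _ _ _ (fun e : R => - e * `|y|)); last exact: continuous_expR.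
    by apply: cvgM; [apply: cvgN; exact: cvg_id|exact: cvg_cst].
  by have := cvg_harmonic_comp C0; rewrite oppr0 mul0r expR0.
- exact: (integrable_norm ig).
- move=> n y _; rewrite normrM gtr0_norm ?expR_gt0//.
  have h : expR (- n.+1%:R^-1 * `|y|) <= 1.
    by rewrite -expR0 ler_expR mulNr oppr_le0 mulr_ge0.
  by rewrite ler_piMl.
Qed.

Lemma Cahen_Mellin_integrable : cintegrable setT G.
Proof. exact: iG. Qed.

(** The regularized integrals have two limits, which must agree: the integral of [G], because [G] is
    integrable, and the value produced by the Poisson kernel. *)
Lemma Cahen_Mellin :
  cintegral setT (fun y => cGamma (c +i* y) * cpow x (- (c +i* y))) =
  (2 * pi * expR (- x))%:C.
Proof.
have [iR iI] := iG.
have e0 n : 0 < (n.+1%:R^-1 : R) by rewrite invr_gt0.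
have R1 n : \int[mu]_y (expR (- n.+1%:R^-1 * `|y|) * complex.Re (G y)) =
    \int[mu]_u A n.+1%:R^-1 u.
  transitivity (complex.Re (cintegral setT (fun y => Phi n.+1%:R^-1 y * G y))); last by rewrite regularized.
  by apply: eq_Rintegral => y _; rewrite ReZ.
have I1 n : \int[mu]_y (expR (- n.+1%:R^-1 * `|y|) * complex.Im (G y)) = 0.
  transitivity (complex.Im (cintegral setT (fun y => Phi n.+1%:R^-1 y * G y))); last by rewrite regularized.
  by apply: eq_Rintegral => y _; rewrite ImZ.
apply: complex_eqP; rewrite ?Re_cintegral ?Im_cintegral.
  have := cvgPhi iR; under eq_fun do rewrite R1.
  by move=> h; apply: (cvg_unique _ h cvgA).
have := cvgPhi iI; under eq_fun do rewrite I1.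
by move=> h; apply: (cvg_unique _ h (cvg_cst 0)).
Qed.

End CahenMellin.

(** The reflection y -> -y, suited to factors Gamma(-s) x^s on a line to the left of 0. *)
Lemma Cahen_Mellin_neg (R : realType) (c x : R) : c < 0 -> 0 < x ->
  cintegrable setT (fun y => cGamma (- (c +i* y)) * cpow x (c +i* y)) /\
  cintegral setT (fun y => cGamma (- (c +i* y)) * cpow x (c +i* y)) =
  (2 * pi * expR (- x))%:C.
Proof.
move=> c0 x0; have nc0 : 0 < - c by rewrite oppr_gt0.
have i1 := Cahen_Mellin_integrable x nc0; have e1 := Cahen_Mellin nc0 x0.
have n1 : (-1 : R) != 0 by rewrite oppr_eq0 oner_eq0.
have [i2 e2] := cintegral_scale n1 i1.
have E y : cGamma ((- c) +i* (-1 * y)) * cpow x (- ((- c) +i* (-1 * y))) =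
    cGamma (- (c +i* y)) * cpow x (c +i* y).
  congr (cGamma _ * cpow _ _); apply: complex_eqP => //=; rewrite ?opprK// mulN1r ?opprK//.
split; first by apply: eq_cintegrable i2.
rewrite -e1 e2 normrN1 mul1r; apply: eq_cintegral => y _; exact/esym/E.
Qed.

(** The phase brought in by an Euler integral is absorbed by rescaling the base from [x] to [x * w],
    at the price of the real factor w^(-a). *)
Lemma cpow_phase (R : realType) (x w a b : R) : 0 < x -> 0 < w ->
  cis (b * ln w) * cpow x (a +i* b) = (expR (- a * ln w))%:C * cpow (x * w) (a +i* b).
Proof.
move=> x0 w0; rewrite !cpowE lnM ?posrE// mulrDl mulrDl cisD expRD realCM.
rewrite mulNr expRN (mulrC (ln w) a) (mulrC (ln w) b).
have e0 : (expR (a * ln w))%:C != 0 :> R[i] by rewrite eq_complex/= negb_and gt_eqF ?expR_gt0.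
rewrite (fmorphV (real_complex R)) -[LHS]mul1r -(mulVf e0); ring.
Qed.

Lemma norm1_cpow (R : realType) (x a b : R) : norm1 (cpow x (a +i* b)) <= 2 * expR (ln x * a).
Proof.
rewrite cpowE (le_trans (norm1M _ _))// norm1_real gtr0_norm ?expR_gt0// mulrC.
by rewrite ler_wpM2r ?expR_ge0// norm1_cis.
Qed.

Lemma cpow_measurable (R : realType) (x a : R) :
  measurable_fun setT (fun y : R => complex.Re (cpow x (a +i* y))) /\
  measurable_fun setT (fun y : R => complex.Im (cpow x (a +i* y))).
Proof.
have cl : continuous (fun y : R => ln x * y) by exact: mulrl_continuous.
split.
  under eq_fun do rewrite cpowE ReZ.
  apply: continuous_measurable_fun => y; apply: cvgM; first exact: cvg_cst.
  by apply: (@continuous_comp _ _ _ (fun y => ln x * y)); [exact: cl|exact: continuous_cos].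
under eq_fun do rewrite cpowE ImZ.
apply: continuous_measurable_fun => y; apply: cvgM; first exact: cvg_cst.
by apply: (@continuous_comp _ _ _ (fun y => ln x * y)); [exact: cl|exact: continuous_sin].
Qed.

Lemma cintegrable_cpow_mul (R : realType) (x a : R) (f : R -> R[i]) :
  cintegrable setT f -> cintegrable setT (fun y => f y * cpow x (a +i* y)).
Proof.
move=> if_; have [m1 m2] := cpow_measurable x a.
apply: (@eq_cintegrable _ _ (fun y => cpow x (a +i* y) * f y)) => //.
  by move=> y _; rewrite mulrC.
by apply: (@le_cintegrable_mulr _ _ _ _ (2 * expR (ln x * a))) => // y _; exact: norm1_cpow.
Qed.

Lemma cGamma_line_measurable (R : realType) (c a : R) : 0 < c ->
  measurable_fun setT (fun y : R => complex.Re (cGamma (c +i* (a * y)))) /\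
  measurable_fun setT (fun y : R => complex.Im (cGamma (c +i* (a * y)))).
Proof.
move=> c0; have [m1 m2] := cGamma_measurable c0.
have ma : measurable_fun setT (fun y : R => a * y) by exact: measurable_funM.
by split; [exact: (measurableT_comp m1 ma)|exact: (measurableT_comp m2 ma)].
Qed.

Lemma cintegrable_GammaM (R : realType) (c c' a a' : R) : 0 < c -> 0 < c' -> a' != 0 ->
  cintegrable setT (fun y : R => cGamma (c +i* (a * y)) * cGamma (c' +i* (a' * y))).
Proof.
move=> c0 c'0 a'0; have [m1 m2] := cGamma_line_measurable a c0.
have [K K0 hK] := norm1_cGamma c0.
have [i1 _] := cintegral_scale a'0 (cintegrable_cGamma c'0).
by apply: (@le_cintegrable_mulr _ _ _ _ K).
Qed.

(** * The two one-variable Mellin-Barnes integrals *)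

(** With Gamma(1 + s) written as an Euler integral, the line integral becomes Cahen-Mellin for
    Gamma(-s) at [x * w], and there remains the integral of e^(-(1 + x) w) over w > 0. *)
Lemma mellin_inv1p (R : realType) (c x : R) : -1 < c -> c < 0 -> 0 < x ->
  cintegral setT (fun y => cGamma (- (c +i* y)) * cGamma (1 + (c +i* y)) * cpow x (c +i* y)) =
  (2 * pi / (1 + x))%:C.
Proof.
move=> cN1 c0 x0; have c1 : 0 < 1 + c by lra.
have [i1 e1] := Cahen_Mellin_neg c0 x0.
have GE y : cGamma (1 + (c +i* y)) =
    cintegral `]0, +oo[ (fun w => cis (y * ln w) * (gamma_kernel (1 + c) w)%:C).
  by rewrite -cGammaE; congr cGamma; apply: complex_eqP => //=; rewrite add0r.
under eq_cintegral do rewrite mulrAC GE.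
rewrite (phase_Fubini (@measurable_ln R) _ i1 (cintegrable_gamma c1))//.
rewrite (@eq_cintegral _ _ _ (fun w => (2 * pi * expR (- (1 + x) * w))%:C)).
  rewrite cintegral_real; congr (_%:C).
  rewrite RintegralZl//; last by apply: integrable_expRN; lra.
  by rewrite /Rintegral integral_expRN//; lra.
move=> w /=; rewrite in_itv/= andbT => w0.
under eq_cintegral do rewrite mulrCA cpow_phase// mulrCA.
have [i2 e2] := Cahen_Mellin_neg c0 (mulr_gt0 x0 w0).
rewrite cintegralZl// e2 -!realCM /gamma_kernel; congr (_%:C).
rewrite mulrCA (mulrA (expR _)) mulrCA -!mulrA; congr (_ * (_ * _)).
by rewrite -!expRD; congr expR; ring.
Qed.

Lemma continuous_bessel_integrand (R : realType) (r q w : R) : 0 < w ->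
  {for w, continuous (fun w => expR (- r * w - q / w))}.
Proof.
move=> w0.
apply: (@continuous_comp _ _ _ (fun w => - r * w - q / w)); last exact: continuous_expR.
apply: cvgB; first exact: mulrl_continuous.
by apply: cvgM; [exact: cvg_cst|apply: inv_continuous; rewrite gt_eqF].
Qed.

Lemma integrable_bessel (R : realType) (r q : R) : 0 < r -> 0 <= q ->
  (@lebesgue_measure R).-integrable (`]0, +oo[ : set R)
    (EFin \o (fun w => expR (- r * w - q / w))).
Proof.
move=> r0 q0; apply: (le_integrableR _ _ (integrable_expRN r0)) => //.
  apply: open_continuous_measurable_fun; first exact: interval_open.
  by move=> w; rewrite inE/= in_itv/= andbT; exact: continuous_bessel_integrand.
move=> w /=; rewrite in_itv/= andbT => w0.
by rewrite gtr0_norm ?expR_gt0// ler_expR gerBl divr_ge0// ltW.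
Qed.

(* For q > 0 this is 2 * sqrt (q / r) * K_1 (2 * sqrt (r * q)), with K_1 the modified Bessel
   function of the second kind. *)
Definition bessel_integral (R : realType) (r q : R) : R :=
  \int[lebesgue_measure]_(w in `]0, +oo[) expR (- r * w - q / w).

Lemma mellin_bessel (R : realType) (c x : R) : c < -1 -> 0 < x ->
  cintegral setT (fun y => (cGamma (1 / 2 - (c +i* y) / 2) * cGamma (- (1 / 2) - (c +i* y) / 2)) *
    cpow x (c +i* y)) =
  (4 * pi / x * bessel_integral 1 (x ^+ 2))%:C.
Proof.
move=> cN1 x0.
(* The two Gamma arguments are b - i y / 2 and -(a + i y / 2). The first is expanded by Euler's
   integral, the second is left to Cahen-Mellin, which requires a < 0, that is, c < -1. *)
pose b : R := (1 - c) / 2; pose a : R := (c + 1) / 2.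
have b0 : 0 < b by rewrite /b; lra.
have a0 : a < 0 by rewrite /a; lra.
have half : (2 : R[i])^-1 = (2^-1 : R)%:C.
  by rewrite (fmorphV (real_complex R)) rmorph_nat.
have E1 y : 1 / 2 - (c +i* y) / 2 = b +i* (- (y / 2)) :> R[i].
  rewrite mul1r half; apply: complex_eqP => /=; rewrite /b; lra.
have E2 y : - (1 / 2) - (c +i* y) / 2 = - (a +i* (2^-1 * y)) :> R[i].
  rewrite mul1r half; apply: complex_eqP => /=; rewrite /a; lra.
have na : 0 < - a by lra.
have h0 : (2^-1 : R) != 0 by rewrite invr_eq0.
have nh0 : - (2^-1 : R) != 0 by rewrite oppr_eq0.
have iPhi z : cintegrable setT (fun y => cGamma (- (a +i* (2^-1 * y))) * cpow z (c +i* y)).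
  apply: cintegrable_cpow_mul.
  have [i1 _] := cintegral_scale nh0 (cintegrable_cGamma na).
  apply: eq_cintegrable i1 => // y _; congr cGamma; apply: complex_eqP => //=.
  by rewrite mulNr.
have GE y : cGamma (b +i* (- (y / 2))) =
    cintegral `]0, +oo[ (fun w => cis (y * (- (ln w / 2))) * (gamma_kernel b w)%:C).
  rewrite cGammaE; apply: eq_cintegral => w _; congr (cis _ * _); ring.
under eq_cintegral do rewrite E1 E2 -mulrA mulrC GE.
have mL : measurable_fun setT (fun w : R => - (ln w / 2)).
  by apply: measurableT_comp => //; apply: measurable_funM => //; exact: measurable_ln.
rewrite (phase_Fubini mL _ (iPhi x) (cintegrable_gamma b0))//.
rewrite (@eq_cintegral _ _ _ (fun w => (4 * pi / x * expR (- 1 * w - x ^+ 2 / w))%:C)).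
  rewrite cintegral_real; congr (_%:C).
  by rewrite RintegralZl//; apply: integrable_bessel; rewrite ?sqr_ge0.
move=> w /=; rewrite in_itv/= andbT => w0.
have xw0 : 0 < x ^+ 2 / w by rewrite divr_gt0// exprn_gt0.
have [i2 e2] := Cahen_Mellin_neg a0 xw0.
have [i3 e3] := cintegral_scale h0 i2.
(* Since c = 2 a - 1, the power x^(c + i y) equals x^(-1) times (x^2)^(a + i y / 2); the phase w^(-i
   y / 2) then turns the base x^2 into x^2 / w and leaves w^a. *)
have PE y : cis (y * - (ln w / 2)) * (cGamma (- (a +i* (2^-1 * y))) * cpow x (c +i* y)) =
    (expR (a * ln w) / x)%:C *
    (cGamma (- (a +i* (2^-1 * y))) * cpow (x ^+ 2 / w) (a +i* (2^-1 * y))).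
  rewrite mulrCA [RHS]mulrCA; congr (_ * _).
  have xi : x^-1 = expR (- ln x) by rewrite expRN lnK.
  rewrite !cpowE mulrCA -cisD [RHS]mulrA -realCM xi ln_div ?posrE ?exprn_gt0// lnXn//.
  by rewrite -!expRD; congr ((expR _)%:C * cis _); rewrite /a mulr2n; field.
under eq_cintegral do rewrite PE.
rewrite cintegralZl//.
(* The imaginary part is y / 2, which doubles the integral and turns 2 pi into 4 pi. *)
have -> : cintegral setT (fun y => cGamma (- (a +i* (2^-1 * y))) * cpow (x ^+ 2 / w) (a +i* (2^-1 * y))) =
   (4 * pi * expR (- (x ^+ 2 / w)))%:C.
  have -> : cintegral setT (fun y => cGamma (- (a +i* (2^-1 * y))) *
      cpow (x ^+ 2 / w) (a +i* (2^-1 * y))) = 2%:C * cintegral setT (fun y =>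
      cGamma (- (a +i* y)) * cpow (x ^+ 2 / w) (a +i* y)).
    by rewrite e3 gtr0_norm ?invr_gt0// mulrA -realCM divff// mul1r.
  by rewrite e2 -realCM; congr (_%:C); ring.
rewrite -!realCM; congr (_%:C).
rewrite /gamma_kernel.
have -> : expR ((b - 1) * ln w - w) * (expR (a * ln w) / x * (4 * pi * expR (- (x ^+ 2 / w)))) =
  4 * pi / x * (expR ((b - 1) * ln w - w) * expR (a * ln w) * expR (- (x ^+ 2 / w))) by ring.
(* The powers of [w] cancel because a + b = 1. *)
congr (_ * _); rewrite -!expRD; congr expR; rewrite /a /b; field; exact: lt0r_neq0.
Qed.

(** * Evaluation of the bivariate H-function *)

Section foxH_evaluation.
Variables (R : realType) (c1 c2 tau1 tau2 : R).
Hypothesis adm : admissible_lines c1 c2.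
Hypotheses (tau1_gt0 : 0 < tau1) (tau2_gt0 : 0 < tau2).
Let mu := @lebesgue_measure R.

Let c1N1 : -1 < c1. Proof. by case: adm. Qed.
Let c10 : c1 < 0. Proof. by case: adm. Qed.
Let c2N1 : c2 < -1. Proof. by case: adm. Qed.
Let c120 : 0 < 2 + c1 + c2. Proof. by case: adm; lra. Qed.

Let G1 (y : R) : R[i] := cGamma (- (c1 +i* y)) * cGamma (1 + (c1 +i* y)).
Let G2 (y : R) : R[i] := cGamma (1 / 2 - (c2 +i* y) / 2) * cGamma (- (1 / 2) - (c2 +i* y) / 2).
Let Phi1 (y : R) : R[i] := G1 y * cpow tau1 (c1 +i* y).
Let Phi2 (y : R) : R[i] := G2 y * cpow tau2 (c2 +i* y).

Let iG1 tau : cintegrable setT (fun y => G1 y * cpow tau (c1 +i* y)).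
Proof.
apply: cintegrable_cpow_mul.
have h1 : 0 < - c1 by rewrite oppr_gt0.
have h2 : 0 < 1 + c1 by have := c1N1; lra.
have := cintegrable_GammaM (-1) h1 h2 (oner_neq0 R).
apply: eq_cintegrable => // y _; rewrite /G1; congr (cGamma _ * cGamma _);
  apply: complex_eqP => //=; ring.
Qed.

Let iG2 tau : cintegrable setT (fun y => G2 y * cpow tau (c2 +i* y)).
Proof.
apply: cintegrable_cpow_mul.
have h1 : 0 < (1 - c2) / 2 by have := c2N1; lra.
have h2 : 0 < - ((c2 + 1) / 2) by have := c2N1; lra.
have h0 : - (2^-1 : R) != 0 by rewrite oppr_eq0 invr_eq0.
have half : (2 : R[i])^-1 = (2^-1 : R)%:C.
  by rewrite (fmorphV (real_complex R)) rmorph_nat.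
have := cintegrable_GammaM (- 2^-1) h1 h2 h0.
apply: eq_cintegrable => // y _; rewrite /G2; congr (cGamma _ * cGamma _);
  rewrite mul1r half; apply: complex_eqP => /=; lra.
Qed.

Let iPhi1 : cintegrable setT Phi1. Proof. exact: iG1. Qed.
Let iPhi2 : cintegrable setT Phi2. Proof. exact: iG2. Qed.

Let inner1 (w : R) : 0 < w ->
  cintegral setT (fun y => cis (y * ln w) * Phi1 y) =
  (expR (- c1 * ln w) * (2 * pi / (1 + tau1 * w)))%:C.
Proof.
move=> w0; rewrite realCM -(mellin_inv1p c1N1 c10 (mulr_gt0 tau1_gt0 w0)).
rewrite -(cintegralZl (expR (- c1 * ln w))%:C measurableT (iG1 (tau1 * w))).
by apply: eq_cintegral => y _; rewrite /Phi1 mulrCA cpow_phase// mulrCA.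
Qed.

Let inner2 (w : R) : 0 < w ->
  cintegral setT (fun y => cis (y * ln w) * Phi2 y) =
  (expR (- c2 * ln w) * (4 * pi / (tau2 * w) * bessel_integral 1 ((tau2 * w) ^+ 2)))%:C.
Proof.
move=> w0; rewrite realCM -(mellin_bessel c2N1 (mulr_gt0 tau2_gt0 w0)).
rewrite -(cintegralZl (expR (- c2 * ln w))%:C measurableT (iG2 (tau2 * w))).
by apply: eq_cintegral => y _; rewrite /Phi2 mulrCA cpow_phase// mulrCA.
Qed.

Let a : R := 2 + c1 + c2.
(** The s-phase of Gamma(2 + s + t) is part of the weight, so that the t-integral is a phase
    integral in y2 alone. *)
Let psi2 (y1 w : R) : R[i] := cis (y1 * ln w) * (gamma_kernel a w)%:C.
(** What the t-integral leaves. It is real and free of y1, so the s-integral is again a phase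
    integral, with [B] as weight. *)
Let B (w : R) : R := gamma_kernel a w *
  (expR (- c2 * ln w) * (4 * pi / (tau2 * w) * bessel_integral 1 ((tau2 * w) ^+ 2))).

Let ipsi2 y1 : cintegrable `]0, +oo[ (psi2 y1).
Proof. by apply: (cintegrable_phase_r (@measurable_ln R)) => //; exact: cintegrable_gamma. Qed.

Let GammaE y1 y2 : cGamma (2 + (c1 +i* y1) + (c2 +i* y2)) =
  cintegral `]0, +oo[ (fun w => cis (y2 * ln w) * psi2 y1 w).
Proof.
have -> : 2 + (c1 +i* y1) + (c2 +i* y2) = a +i* (y1 + y2).
  by apply: complex_eqP => /=; rewrite /a; ring.
rewrite cGammaE; apply: eq_cintegral => w _.
by rewrite /psi2 mulrDl cisD; ring.
Qed.

(** No estimate of [B] is made: its integrability is that of the exchanged integral at y1 = 0, where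
    the s-phase equals 1. *)
Let iB : cintegrable `]0, +oo[ (fun w => (B w)%:C).
Proof.
have := phase_Fubini_integrable (@measurable_ln R) (measurable_itv `]0, +oo[) iPhi2 (ipsi2 0).
apply: eq_cintegrable => // w /=; rewrite in_itv/= andbT => w0.
by rewrite inner2// /psi2 mul0r cis0 mul1r -realCM.
Qed.

Let integral_t y1 :
  cintegral setT (fun y2 => Phi2 y2 * cGamma (2 + (c1 +i* y1) + (c2 +i* y2))) =
  cintegral `]0, +oo[ (fun w => cis (y1 * ln w) * (B w)%:C).
Proof.
under eq_cintegral do rewrite GammaE.
rewrite (phase_Fubini (@measurable_ln R) _ iPhi2 (ipsi2 y1))//.
apply: eq_cintegral => w /=; rewrite in_itv/= andbT => w0.
by rewrite inner2// /psi2 -mulrA -realCM.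
Qed.

Let iGammaPhi2 y1 :
  cintegrable setT (fun y2 => Phi2 y2 * cGamma (2 + (c1 +i* y1) + (c2 +i* y2))).
Proof.
have := phase_Fubini_integrable_l (@measurable_ln R) (measurable_itv `]0, +oo[) iPhi2 (ipsi2 y1).
by apply: eq_cintegrable => // y2 _; rewrite GammaE.
Qed.

Let double_integral :
  cintegral setT (fun y1 => Phi1 y1 * cintegral `]0, +oo[ (fun w => cis (y1 * ln w) * (B w)%:C)) =
  (8 * pi ^+ 2 / tau2 *
    \int[mu]_(w in `]0, +oo[) (expR (- w) * bessel_integral 1 ((tau2 * w) ^+ 2) / (1 + tau1 * w)))%:C.
Proof.
rewrite (phase_Fubini (@measurable_ln R) _ iPhi1 iB)//.
have i1 := phase_Fubini_integrable (@measurable_ln R) (measurable_itv `]0, +oo[) iPhi1 iB.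
have K0 : 8 * pi ^+ 2 / tau2 != 0 :> R.
  by rewrite !mulf_neq0// ?invr_eq0 ?expf_neq0// lt0r_neq0// pi_gt0.
have E (w : R) : 0 < w -> (B w)%:C * cintegral setT (fun y => cis (y * ln w) * Phi1 y) =
    (8 * pi ^+ 2 / tau2 * (expR (- w) * bessel_integral 1 ((tau2 * w) ^+ 2) / (1 + tau1 * w)))%:C.
  move=> w0; rewrite inner1// -realCM; congr (_%:C); rewrite /B.
  have D0 : 1 + tau1 * w != 0 by rewrite lt0r_neq0// addr_gt0// mulr_gt0.
  have -> : gamma_kernel a w * (expR (- c2 * ln w) * (4 * pi / (tau2 * w) *
      bessel_integral 1 ((tau2 * w) ^+ 2))) * (expR (- c1 * ln w) * (2 * pi / (1 + tau1 * w))) =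
      (gamma_kernel a w * expR (- c2 * ln w) * expR (- c1 * ln w)) *
      (8 * pi ^+ 2 / (tau2 * w) * (bessel_integral 1 ((tau2 * w) ^+ 2)) / (1 + tau1 * w)) by ring.
  (* The powers w^(1 + c1 + c2), w^(-c1) and w^(-c2) combine to w, so the result does not depend on
     the position of the lines. This w then cancels the one in [tau2 * w]. *)
  have -> : gamma_kernel a w * expR (- c2 * ln w) * expR (- c1 * ln w) = w * expR (- w).
    by rewrite -[X in _ = X * _](lnK w0) -!expRD; congr expR; rewrite /a; ring.
  by field; rewrite D0 !lt0r_neq0.
rewrite (@eq_cintegral _ _ _ (fun w => (8 * pi ^+ 2 / tau2 *
   (expR (- w) * bessel_integral 1 ((tau2 * w) ^+ 2) / (1 + tau1 * w)))%:C)); last first.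
  by move=> w /=; rewrite in_itv/= andbT; exact: E.
rewrite cintegral_real RintegralZl//.
(* Integrability, needed to take the constant out, is again inherited from the exchange, after
   division by the nonzero constant. *)
have i2 : cintegrable `]0, +oo[ (fun w => (expR (- w) * bessel_integral 1 ((tau2 * w) ^+ 2) /
    (1 + tau1 * w))%:C).
  apply: (eq_cintegrable _ _ (cintegrableZl (8 * pi ^+ 2 / tau2)^-1%:C _ i1)) => // w wD.
  have w0 : 0 < w by move: wD; rewrite /= in_itv/= andbT.
  by rewrite E// -realCM mulrA mulVf// mul1r.
exact: i2.1.
Qed.

Lemma foxHE : foxH c1 c2 tau1 tau2 =
  (2 / tau2 * \int[mu]_(w in `]0, +oo[)
    (expR (- w) * bessel_integral 1 ((tau2 * w) ^+ 2) / (1 + tau1 * w)))%:C.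
Proof.
set I := \int[mu]_(w in _) _.
pose ii : R[i] := 0 +i* 1.
have inner y1 : vline_integral c2 (fun t =>
    cGamma (2 + (c1 +i* y1) + t) * (cGamma (- (c1 +i* y1)) * cGamma (1 + (c1 +i* y1))) *
    (cGamma (1 / 2 - t / 2) * cGamma (- (1 / 2) - t / 2)) *
    cpow tau1 (c1 +i* y1) * cpow tau2 t) =
    ii * (Phi1 y1 * cintegral `]0, +oo[ (fun w => cis (y1 * ln w) * (B w)%:C)).
  rewrite /vline_integral; congr (_ * _).
  rewrite -integral_t -cintegralZl//.
  by apply: eq_cintegral => y2 _; rewrite /Phi1 /Phi2 /G1 /G2; ring.
rewrite /foxH {1}/vline_integral.
under eq_cintegral do rewrite inner.
rewrite cintegralZl//; last first.
  exact: (phase_Fubini_integrable_l (@measurable_ln R) (measurable_itv `]0, +oo[) iPhi1 iB).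
rewrite double_integral -/I -/ii.
have ii2 : ii * ii = - 1 by apply: complex_eqP => /=; ring.
have ii0 : ii != 0 by rewrite eq_complex /= oner_eq0 andbF.
have pi0 : (pi : R) != 0 by rewrite lt0r_neq0// pi_gt0.
have pic0 : (2 * pi)%:C != 0 :> R[i].
  by rewrite eq_complex /= negb_and mulf_neq0.
rewrite mulrA mulrA.
(* Each upward line contributes a factor i, and i^2 cancels against the i^2 in the normalization. *)
have -> : ((2 * pi)%:C * ii) ^- 2 * (ii * ii) = ((2 * pi) ^- 2)%:C.
  rewrite ii2 exprMn (expr2 ii) ii2.
  rewrite (_ : ((2 * pi) ^- 2)%:C = ((2 * pi)%:C ^+ 2)^-1); last by rewrite (fmorphV (real_complex R)) rmorphXn.
  by rewrite !mulrN1 invrN opprK.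
rewrite -realCM; congr (_%:C); move: (pi : R) pi0 => p p0.
by field; rewrite p0 lt0r_neq0.
Qed.

End foxH_evaluation.

(** * Tail of the bound on the SNDR *)

(** On nonnegative values the inverse is the power -1, also at 0, where both are 0. *)
Lemma measurable_fun_invr (R : realType) d (T : measurableType d) (f : T -> R) :
  measurable_fun setT f -> (forall x, 0 <= f x) -> measurable_fun setT (fun x => (f x)^-1).
Proof.
move=> mf f0; under eq_fun do rewrite -powR_inv1//.
by apply: (@measurableT_comp _ _ _ _ _ _ (fun x : R => x `^ (-1))) => //; exact: measurable_powR.
Qed.

Section joint_law.
Context (R : realType) (d : measure_display) (T : measurableType d) (P : probability T R).
Variables (X Y : {RV P >-> R}).

(** Independence says that the law of the pair agrees with the product measure on rectangles, and
    this determines it. *)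
Lemma independent_joint_law (E : set (R * R)) : independent_rvs X Y -> measurable E ->
  P [set w | E (X w, Y w)] =
  (\int[distribution P X]_x (distribution P Y (xsection E x)))%E.
Proof.
move=> XY mE.
have mXY : measurable_fun setT (fun w => (X w, Y w)).
  by apply: measurable_fun_pair; exact: measurable_funP.
pose jm : {measure set (R * R) -> \bar R} :=
  measure_function_pushforward__canonical__measure_function_Measure P mXY.
have H := @product_measure_unique _ _ _ _ R (distribution P X) (distribution P Y) jm.
by rewrite -[LHS]/(jm E) -H.
Qed.

(** A signed mixture of exponentials is not visibly nonnegative. So [f] is first identified, almost
    everywhere on [0, +oo[, with the Radon-Nikodym derivative of the law of X, for which change of
    variables is available. *)
Lemma integral_density (f : R -> R) (h : R -> \bar R) :
  has_density_on_nonneg X f -> measurable_fun (`[0, +oo[ : set R) f ->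
  (forall x, 0 <= h x)%E -> measurable_fun setT h ->
  (\int[distribution P X]_x h x = \int[lebesgue_measure]_(x in `[0%R, +oo[) (h x * (f x)%:E))%E.
Proof.
move=> Xf mf h0 mh.
pose mu : {sigma_finite_measure set (measurableTypeR R) -> \bar R} := @lebesgue_measure R.
(* [X'] is [X] with the measurable structure on R that [lebesgue_measure] expects; the two
   structures have the same measurable sets but different displays. *)
have mX : measurable_fun setT (X : T -> measurableTypeR R) by exact (@measurable_funPT _ _ _ _ X).
pose X' : {RV P >-> measurableTypeR R} := @mfun_Sub _ _ _ (measurableTypeR R) (X : T -> measurableTypeR R) (mem_set mX).
pose nu : {finite_measure set (measurableTypeR R) -> \bar R} := distribution P X'.
have -> : (\int[distribution P X]_x h x = \int[nu]_x h x)%E.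
  by rewrite ge0_integral_distribution// [RHS]ge0_integral_distribution.
have numu : nu `<< mu.
  apply/null_content_dominatesP => A mA A0; rewrite [LHS]Xf//.
  apply: null_set_integral.
  - exact: measurableI.
  - apply/measurable_EFinP; apply: measurable_funS mf => //; exact: subIsetr.
  - by apply: (subset_measure0 _ _ _ A0) => //; exact: measurableI.
pose fr : R -> \bar R := (EFin \o f) \_ `[0, +oo[.
have mfr : measurable_fun setT fr.
  by apply/(measurable_restrictT _ _).1 => //; apply/measurable_EFinP.
rewrite -(@Radon_Nikodym_SigmaFinite.change_of_variables _ _ R nu mu numu)//.
have ae : ae_eq mu setT (Radon_Nikodym_SigmaFinite.f nu mu) fr.
  apply: integral_ae_eq => //.
    exact: Radon_Nikodym_SigmaFinite.f_integrable.
  move=> A _ mA; rewrite -Radon_Nikodym_SigmaFinite.f_integral//.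
  by rewrite -integral_mkcondr -Xf.
transitivity (\int[mu]_x (h x * fr x))%E.
  apply: ae_eq_integral => //.
  - apply: emeasurable_funM => //.
    exact: measurable_int (Radon_Nikodym_SigmaFinite.f_integrable numu).
  - exact: emeasurable_funM.
  - exact: ae_eqe_mul2l.
rewrite [RHS]integral_mkcond; apply: eq_integral => x _.
by rewrite /fr !patchE; case: ifP => //; rewrite mule0.
Qed.

End joint_law.

Lemma integral_inv1p (R : realType) (a : R) : 0 <= a ->
  (\int[lebesgue_measure]_(z in `]0%R, a[) ((1 + z)^-1)%:E = (ln (1 + a))%:E)%E.
Proof.
move=> a0; have [->|a_neq0] := eqVneq a 0.
  by rewrite addr0 ln1 set_itv_ge ?integral_set0// bnd_simp ltxx.
have {}a0 : 0 < a by rewrite lt_neqAle eq_sym a_neq0.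
have ci (z : R) : -1 < z -> {for z, continuous (fun z : R => (1 + z)^-1)}.
  move=> z1; apply: cvgV; first by rewrite lt0r_neq0//; lra.
  by apply: cvgD; [exact: cvg_cst|exact: cvg_id].
have di (z : R) : -1 < z -> is_derive z (1 : R) (fun z : R => ln (1 + z)) (1 + z)^-1.
  move=> z1; have z0 : 0 < 1 + z by lra.
  apply: (eq_is_derive (@is_derive1_comp R (@ln R) (fun z => 1 + z) z _ _ (is_derive1_ln z0)
    (is_deriveD (is_derive_cst (1 : R) z (1 : R)) (is_derive_id z (1 : R))))) => //.
  by rewrite -[LHS]/((1 + z)^-1 * (0 + 1)) add0r mulr1.
have cl (z : R) : -1 < z -> {for z, continuous (fun z : R => ln (1 + z))}.
  move=> z1; apply: differentiable_continuous; apply/derivable1_diffP.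
  by have [] := di z z1.
have mi : measurable_fun (`[0, a] : set R) (fun z : R => ((1 + z)^-1)%:E).
  apply/measurable_EFinP; apply: (@measurable_funS _ _ _ _ (`]-1, +oo[ : set R)) => //.
    by move=> z /=; rewrite !in_itv/= andbT => /andP[z0 _]; lra.
  apply: open_continuous_measurable_fun; first exact: interval_open.
  by move=> z; rewrite inE/= in_itv/= andbT; exact: ci.
rewrite -(integral_itv_bndoo true false); last first.
  by apply: measurable_funS mi => // z /=; rewrite !in_itv/= => /andP[? ?]; rewrite !ltW.
rewrite (@continuous_FTC2 _ _ (fun z => ln (1 + z)))//.
- by rewrite addr0 ln1 sube0.
- by apply: continuous_in_subspaceT => z; rewrite inE/= in_itv/= => /andP[z0 _]; apply: ci; lra.
- split.
  + move=> z; rewrite in_itv/= => /andP[z0 _].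
    by have [] := di z ltac:(lra).
  + by apply: cvg_at_right_filter; apply: cl; lra.
  + by apply: cvg_at_left_filter; apply: cl; lra.
- move=> z; rewrite in_itv/= => /andP[z0 _].
  by rewrite derive1E; have /@derive_val -> := di z ltac:(lra).
Qed.

(** Tonelli on the region 0 < z < g(w), with ln(1 + g) written as the integral of 1 / (1 + z) over
    ]0, g[. *)
Lemma integral_ln1p_tail (R : realType) (d : measure_display) (T : measurableType d)
    (P : probability T R) (g : T -> R) : measurable_fun setT g -> (forall w, 0 <= g w) ->
  (\int[P]_w (ln (1 + g w))%:E =
   \int[lebesgue_measure]_(z in `]0%R, +oo[) ((1 + z)^-1%:E * P [set w | (z < g w)%R]))%E.
Proof.
move=> mg g0; set mu := @lebesgue_measure R.
pose A : set (T * R) := [set p | 0 < p.2 /\ p.2 < g p.1].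
have mg1 : measurable_fun setT (fun p : T * R => g p.1) by apply: measurableT_comp.
have mA : measurable A.
  have -> : A = ((fun p : T * R => (0 < p.2) && (p.2 < g p.1)) @^-1` [set true]).
    by apply/seteqP; split => p /=; [move=> [-> ->]|move=> /andP].
  rewrite -[X in measurable X]setTI; apply: measurable_and => //.
    by apply: measurable_fun_ltr => //; exact: measurable_snd.
  by apply: measurable_fun_ltr => //; exact: measurable_snd.
(* The absolute value keeps the integrand nonnegative and measurable on the whole product; it
   changes nothing on [A]. *)
pose f (p : T * R) : \bar R := ((`|1 + p.2|)^-1 * \1_A p)%:E.
have mf : measurable_fun setT f.
  apply/measurable_EFinP; apply: measurable_funM; last exact: measurable_indic.
  apply: measurable_fun_invr => //; apply: measurableT_comp => //.
  by apply: measurable_funD => //; exact: measurable_snd.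
have f0 p : (0 <= f p)%E by rewrite lee_fin mulr_ge0// invr_ge0.
have := @fubini_tonelli _ _ T (measurableTypeR R) R P mu f mf f0.
have -> : (\int[P]_x \int[mu]_y f (x, y) = \int[P]_w (ln (1 + g w))%:E)%E.
  apply: eq_integral => w _; rewrite -integral_inv1p// [RHS]integral_mkcond.
  apply: eq_integral => z _; rewrite /f patchE indicE /=.
  rewrite (_ : ((w, z) \in A) = (z \in `]0, g w[%classic)); last first.
    apply/idP/idP; rewrite !inE /A /= in_itv/=; first by move=> [-> ->].
    by move=> /andP.
  case: ifP => [|_]; last by rewrite mulr0.
  by rewrite inE/= in_itv/= mulr1 => /andP[z0 _]; rewrite ger0_norm// addr_ge0// ltW.
move=> ->; rewrite [RHS]integral_mkcond; apply: eq_integral => z _; rewrite patchE.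
case: ifPn => [|z0]; last first.
  rewrite integral0_eq// => w _; rewrite /f indicE (_ : (w, z) \in A = false) ?mulr0//.
  apply: contraNF z0; rewrite !inE /A /= => -[z0 _]; by rewrite in_itv/= z0.
rewrite inE/= in_itv/= andbT => z0.
have mgz : measurable [set w | z < g w].
  rewrite (_ : [set w | z < g w] = g @^-1` `]z, +oo[).
    by rewrite -[X in measurable X]setTI; exact: mg.
  by apply/seteqP; split => w /=; rewrite in_itv/= andbT.
have fE w : f (w, z) = ((1 + z)^-1%:E * (\1_[set w | z < g w] w)%:E)%E.
  rewrite /f -EFinM ger0_norm ?addr_ge0 ?(ltW z0)// !indicE; congr ((_ * (nat_of_bool _)%:R)%:E).
  by apply/idP/idP; rewrite !inE /A /=; [move=> []|split].
under eq_integral do rewrite fE.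
rewrite ge0_integralZl//.
- by rewrite integral_indic// setIT.
- by apply/measurable_EFinP; exact: measurable_indic.
- by rewrite lee_fin invr_ge0 addr_ge0// ltW.
Qed.

(** * Rescaling on the half-line and the tail integrand *)

Lemma ge0_halfline_scale (R : realType) (a : R) (f : R -> R) : 0 < a ->
  measurable_fun (`]0, +oo[ : set R) f -> (forall x : R, 0 < x -> 0 <= f x) ->
  (\int[lebesgue_measure]_(x in `]0%R, +oo[) (f x)%:E =
   a%:E * \int[lebesgue_measure]_(x in `]0%R, +oo[) (f (a * x)%R)%:E)%E.
Proof.
move=> a0 mf f0.
rewrite integral_mkcond (@ge0_integral_affine _ a 0) ?lt0r_neq0//.
- rewrite gtr0_norm// [in RHS]integral_mkcond; congr (_ * _)%E.
  apply: eq_integral => x _; rewrite addr0 !patchE.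
  suff -> : (a * x \in `]0, +oo[%classic) = (x \in `]0, +oo[%classic) by [].
  by apply/idP/idP; rewrite !inE/= !in_itv/= !andbT pmulr_rgt0.
- by apply/(measurable_restrictT _ _).1 => //; apply/measurable_EFinP.
- move=> x; rewrite patchE; case: ifP => //.
  by rewrite inE/= in_itv/= andbT => x0; rewrite lee_fin f0.
Qed.

Lemma ge0_halfline_Rscale (R : realType) (a : R) (f : R -> R) : 0 < a ->
  measurable_fun (`]0, +oo[ : set R) f -> (forall x : R, 0 < x -> 0 <= f x) ->
  \int[lebesgue_measure]_(x in `]0, +oo[) f x =
   a * \int[lebesgue_measure]_(x in `]0, +oo[) f (a * x).
Proof.
move=> a0 mf f0; rewrite /Rintegral (ge0_halfline_scale a0 mf f0).
have : (0 <= \int[lebesgue_measure]_(x in `]0%R, +oo[) (f (a * x)%R)%:E)%E.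
  apply: integral_ge0 => x /=; rewrite in_itv/= andbT => x0.
  by rewrite lee_fin f0// mulr_gt0.
(* When the integral is infinite, both sides read 0 through [fine]. *)
case: (integral _ _ _) => [y| |]//= _.
by rewrite gt0_muley ?lte_fin//= mulr0.
Qed.

Lemma measurable_fun_halfline_continuous (R : realType) (f : R -> R) :
  (forall x : R, 0 < x -> {for x, continuous f}) -> measurable_fun (`]0, +oo[ : set R) f.
Proof.
move=> cf; apply: open_continuous_measurable_fun; first exact: interval_open.
by move=> x; rewrite inE/= in_itv/= andbT; exact: cf.
Qed.

Lemma bessel_integral_scale (R : realType) (r q : R) : 0 < r -> 0 <= q ->
  bessel_integral r q = r^-1 * bessel_integral 1 (r * q).
Proof.
move=> r0 q0; rewrite /bessel_integral.
rewrite [in RHS](@ge0_halfline_Rscale _ r (fun w => expR (- 1 * w - r * q / w)))//.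
- rewrite mulKf ?lt0r_neq0//; apply: eq_Rintegral => w /[!inE]/=; rewrite in_itv/= andbT => w0.
  by congr expR; field; rewrite !lt0r_neq0.
- by apply: measurable_fun_halfline_continuous => w; exact: continuous_bessel_integrand.
Qed.

Lemma bessel_integral_bounds (R : realType) (r q : R) : 0 < r -> 0 <= q ->
  0 <= bessel_integral r q <= r^-1.
Proof.
move=> r0 q0; apply/andP; split.
  by apply: Rintegral_ge0 => w _; exact: expR_ge0.
have <- : \int[lebesgue_measure]_(w in `]0, +oo[) expR (- r * w) = r^-1.
  by rewrite /Rintegral integral_expRN.
apply: le_Rintegral => //; [exact: integrable_bessel|exact: integrable_expRN|].
by move=> w /=; rewrite in_itv/= andbT => w0; rewrite ler_expR gerBl divr_ge0// ltW.
Qed.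

(** Tonelli makes a parametrized integral measurable in its parameter, once the integrand is
    extended by zero to the plane. *)
Lemma measurable_bessel (R : realType) (r q : R) : 0 < r -> 0 <= q ->
  measurable_fun setT (fun z : R => bessel_integral r (q * z ^+ 2)).
Proof.
move=> r0 q0; set mu := @lebesgue_measure R.
pose D : set (R * R) := [set p | 0 < p.2].
have mD : measurable D.
  rewrite (_ : D = (fun p : R * R => p.2) @^-1` `]0, +oo[).
    by rewrite -[X in measurable X]setTI; exact: measurable_snd.
  by apply/seteqP; split => p /=; rewrite in_itv/= andbT.
pose f (p : R * R) : \bar R := (expR (- r * p.2 - q * p.1 ^+ 2 / `|p.2|) * \1_D p)%:E.
have mf : measurable_fun setT f.
  apply/measurable_EFinP; apply: measurable_funM; last exact: measurable_indic.
  apply: measurableT_comp => //; apply: measurable_funB.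
    by apply: measurable_funM => //; exact: measurable_snd.
  apply: measurable_funM.
    apply: measurable_funM => //; apply: measurable_funX; exact: measurable_fst.
  by apply: measurable_fun_invr => //; apply: measurableT_comp => //; exact: measurable_snd.
have f0 p : (0 <= f p)%E by rewrite lee_fin mulr_ge0// expR_ge0.
have := @measurable_fun_fubini_tonelli_F _ _ R (measurableTypeR R) R mu f mf f0.
move=> /(measurableT_comp (@fine_measurable R _ measurableT)); congr (measurable_fun _ _).
apply/funext => z /=; rewrite /bessel_integral /Rintegral /fubini_F; congr fine.
rewrite [RHS]integral_mkcond; apply: eq_integral => w _; rewrite patchE /f indicE.
rewrite (_ : ((z, w) \in D) = (w \in `]0, +oo[%classic)); last first.
  by apply/idP/idP; rewrite !inE /D/= in_itv/= andbT.
case: ifP; last by rewrite mulr0.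
by rewrite inE/= in_itv/= andbT mulr1 => w0; rewrite gtr0_norm.
Qed.

(* What a term e^(-r x) of the density of X and a term e^(-u y) of the ccdf of Y contribute to
   the probability that the bound on the SNDR exceeds z. *)
Definition sndr_tail (R : realType) (zeta r u z : R) : R :=
  expR (- (r * zeta + u) * z) * bessel_integral r (u * zeta * z ^+ 2).

Lemma sndr_tail_integral (R : realType) (zeta r u z : R) :
  0 < zeta -> 0 < r -> 0 < u -> 0 < z ->
  (\int[lebesgue_measure]_(x in `](zeta * z)%R, +oo[)
    (expR (- r * x - u * (z * x / (x - zeta * z))))%:E = (sndr_tail zeta r u z)%:E)%E.
Proof.
move=> zeta0 r0 u0 z0; set mu := @lebesgue_measure R.
pose g (v : R) : R := expR (- (r * zeta + u) * z) * expR (- r * v - u * zeta * z ^+ 2 / v).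
have q0 : 0 <= u * zeta * z ^+ 2 by rewrite !mulr_ge0 ?sqr_ge0// ltW.
have mg : measurable_fun (`]0, +oo[ : set R) g.
  apply: measurable_fun_halfline_continuous => v v0.
  by apply: cvgM; [exact: cvg_cst|exact: continuous_bessel_integrand].
transitivity (\int[mu]_(v in `]0%R, +oo[) (g v)%:E)%E; last first.
  have ib := integrable_bessel r0 q0.
  have ig : mu.-integrable (`]0, +oo[ : set R) (EFin \o g) by exact: integrableZlR.
  by rewrite /sndr_tail -RintegralZl// /Rintegral fineK//; exact: (integrable_fin_num _ ig).
rewrite [RHS]integral_mkcond (@ge0_integral_affine _ 1 (- (zeta * z)))//.
- rewrite normr1 mul1e [LHS]integral_mkcond; apply: eq_integral => x _.
  rewrite !patchE mul1r.
  rewrite (_ : (x - zeta * z \in `]0, +oo[%classic) = (x \in `]zeta * z, +oo[%classic)); last first.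
    by apply/idP/idP; rewrite !inE/= !in_itv/= !andbT subr_gt0.
  case: ifP => //; rewrite inE/= in_itv/= andbT -subr_gt0 => xz.
  (* With v = x - zeta z, the argument z x / v equals z + zeta z^2 / v. *)
  rewrite /= /g -expRD; congr (expR _)%:E; field; exact: lt0r_neq0.
- by apply/(measurable_restrictT _ _).1 => //; apply/measurable_EFinP.
- by move=> x; rewrite patchE; case: ifP => // _; rewrite lee_fin mulr_ge0// expR_ge0.
Qed.

Lemma sndr_le_ub (R : realType) (zeta x y : R) : 0 <= zeta -> 0 <= x -> 0 <= y ->
  sndr zeta x y <= sndr_ub zeta x y.
Proof.
move=> zeta0 x0 y0; rewrite /sndr /sndr_ub.
have zy0 : 0 <= zeta * y by exact: mulr_ge0.
(* The case x = 0 is separate because it contains the quotient 0 / 0; both numerators vanish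
   there. *)
have [->|x_neq0] := eqVneq x 0; first by rewrite !mul0r.
have {}x0 : 0 < x by rewrite lt_neqAle eq_sym x_neq0.
by apply: ler_wpM2l; [rewrite mulr_ge0// ltW|rewrite lef_pV2 ?posrE; lra].
Qed.

(** The condition is free of division, hence visibly measurable in the pair (x, y). When x <= zeta z
    it fails by sign, since y is nonnegative. *)
Lemma lt_sndr_ub (R : realType) (zeta x y z : R) : 0 < zeta -> 0 <= x -> 0 <= y -> 0 < z ->
  (z < sndr_ub zeta x y) = (zeta * z < x) && (z * x < y * (x - zeta * z)).
Proof.
move=> zeta0 x0 y0 z0; rewrite /sndr_ub.
have zz : 0 < zeta * z by exact: mulr_gt0.
have [xE|x_neq0] := eqVneq x 0.
  by rewrite xE !mul0r ltNge ltW//= ltNge ltW.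
have {}x0 : 0 < x by rewrite lt_neqAle eq_sym x_neq0.
have zy0 : 0 <= zeta * y by rewrite mulr_ge0// ltW.
rewrite ltr_pdivlMr; last by lra.
have -> : (z * (x + zeta * y) < x * y) = (z * x < y * (x - zeta * z)).
  by rewrite -subr_gt0 -[RHS]subr_gt0; congr (_ < _); ring.
have [//|xz] := ltP (zeta * z) x.
apply/negbTE; rewrite -leNgt (@le_trans _ _ 0)//; last by rewrite mulr_ge0// ltW.
by rewrite mulr_ge0_le0// subr_le0.
Qed.

Section sndr_ub_tail.
Context (R : realType) (d : measure_display) (T : measurableType d) (P : probability T R).
Variables (X Y : {RV P >-> R}) (zeta : R).
Hypotheses (zeta0 : 0 < zeta) (X0 : forall w, 0 <= X w) (Y0 : forall w, 0 <= Y w).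

Lemma measurable_sndr : measurable_fun setT (fun w => sndr zeta (X w) (Y w)).
Proof.
apply: measurable_funM; first by apply: measurable_funM; exact: measurable_funP.
apply: measurable_fun_invr => [|w].
  apply: measurable_funD => //; apply: measurable_funD; last exact: measurable_funP.
  by apply: measurable_funM => //; exact: measurable_funP.
by rewrite !addr_ge0// ?mulr_ge0// ltW.
Qed.

Lemma measurable_sndr_ub : measurable_fun setT (fun w => sndr_ub zeta (X w) (Y w)).
Proof.
apply: measurable_funM; first by apply: measurable_funM; exact: measurable_funP.
apply: measurable_fun_invr => [|w].
  apply: measurable_funD; first exact: measurable_funP.
  by apply: measurable_funM => //; exact: measurable_funP.
by rewrite addr_ge0// mulr_ge0// ltW.
Qed.

Lemma sndr_ge0 w : 0 <= sndr zeta (X w) (Y w).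
Proof. by rewrite /sndr divr_ge0 ?mulr_ge0// !addr_ge0// ?mulr_ge0// ltW. Qed.

Lemma sndr_ub_ge0 w : 0 <= sndr_ub zeta (X w) (Y w).
Proof. by rewrite /sndr_ub divr_ge0 ?mulr_ge0// addr_ge0// mulr_ge0// ltW. Qed.

(** For x > zeta z the section at x of the event is the half-line beyond z x / (x - zeta z), whose
    mass is a value of the ccdf of Y; for smaller x it is empty. *)
Lemma sndr_ub_tail (f : R -> R) (z : R) : 0 < z -> independent_rvs X Y ->
  has_density_on_nonneg X f -> measurable_fun (`[0, +oo[ : set R) f ->
  P [set w | z < sndr_ub zeta (X w) (Y w)] =
  (\int[lebesgue_measure]_(x in `](zeta * z)%R, +oo[)
     (ccdf Y (z * x / (x - zeta * z))%R * (f x)%:E))%E.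
Proof.
move=> z0 XY Xf mf.
have zz : 0 < zeta * z by exact: mulr_gt0.
pose E : set (R * R) := [set p | (zeta * z < p.1) && (z * p.1 < p.2 * (p.1 - zeta * z))].
have mE : measurable E.
  rewrite -[E]setTI; apply: (@measurable_and _ _ _ (fun p : R * R => zeta * z < p.1)) => //.
    by apply: measurable_fun_ltr => //; exact: measurable_fst.
  apply: measurable_fun_ltr.
    by apply: measurable_funM => //; exact: measurable_fst.
  apply: measurable_funM; first exact: measurable_snd.
  by apply: measurable_funB => //; exact: measurable_fst.
have -> : [set w | z < sndr_ub zeta (X w) (Y w)] = [set w | E (X w, Y w)].
  by apply/seteqP; split => w /=; rewrite lt_sndr_ub.
rewrite independent_joint_law// (integral_density Xf)//; last first.
  exact: measurable_fun_xsection.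
rewrite integral_mkcond [RHS]integral_mkcond; apply: eq_integral => x _.
rewrite !patchE.
have [zx|xz] := ltP (zeta * z) x.
  have -> : (x \in `[0, +oo[%classic) = true.
    by apply/mem_set => /=; rewrite in_itv/= andbT ltW// (lt_trans zz).
  have -> : (x \in `](zeta * z), +oo[%classic) = true.
    by apply/mem_set => /=; rewrite in_itv/= andbT.
  congr (_ * _)%E; congr (distribution P Y _).
  apply/seteqP; split => y; rewrite /xsection/= in_itv/= andbT inE.
    by rewrite /E/= zx/= ltr_pdivrMr// subr_gt0.
  by rewrite /E/= zx/= ltr_pdivrMr// subr_gt0.
have -> : (x \in `](zeta * z), +oo[%classic) = false.
  by apply/memNset => /=; rewrite in_itv/= andbT ltNge xz.
have -> : xsection E x = set0.
  by apply/seteqP; split => y //; rewrite /xsection/= inE /E/= ltNge xz.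
by rewrite measure0 mul0e; case: ifP.
Qed.

End sndr_ub_tail.

(** * Capacity of exponential mixtures *)

Lemma integrable_lincomb (R : realType) (D : set R) (K : Type) (s : seq K) (c : K -> R)
    (e : K -> R -> R) : measurable D ->
  (forall k, (@lebesgue_measure R).-integrable D (EFin \o e k)) ->
  (@lebesgue_measure R).-integrable D (EFin \o (fun x => \sum_(k <- s) c k * e k x)).
Proof.
move=> mD ie; elim: s => [|k s IH].
  rewrite (_ : _ \o _ = cst 0%E); first exact: integrable0.
  by apply/funext => x /=; rewrite big_nil.
rewrite (_ : _ \o _ = ((EFin \o (fun x => (c k * e k x)%R)) \+
    (EFin \o (fun x => (\sum_(k <- s) c k * e k x)%R)))%E); last first.
  by apply/funext => x /=; rewrite big_cons EFinD.
by apply: integrableD => //; exact: integrableZlR.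
Qed.

Lemma integral_lincomb (R : realType) (D : set R) (K : Type) (s : seq K) (c : K -> R)
    (e : K -> R -> R) : measurable D ->
  (forall k, (@lebesgue_measure R).-integrable D (EFin \o e k)) ->
  (\int[lebesgue_measure]_(x in D) (\sum_(k <- s) c k * e k x)%:E =
   (\sum_(k <- s) c k * \int[lebesgue_measure]_(x in D) e k x)%R%:E)%E.
Proof.
move=> mD ie; elim: s => [|k s IH].
  by under eq_integral do rewrite big_nil; rewrite integral0 big_nil.
under eq_integral do rewrite big_cons EFinD.
have ick := integrableZlR (c k) mD (ie k).
rewrite integralD//; last exact: integrable_lincomb.
rewrite IH big_cons EFinD -RintegralZl//; congr (_ + _)%E.
by rewrite /Rintegral fineK//; exact: (integrable_fin_num _ ick).
Qed.

Lemma sndr_tail_bounds (R : realType) (zeta r u z : R) : 0 <= zeta -> 0 < r -> 0 <= u ->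
  0 <= sndr_tail zeta r u z <= r^-1 * expR (- (r * zeta + u) * z).
Proof.
move=> zeta0 r0 u0.
have /andP[b0 b1] : 0 <= bessel_integral r (u * zeta * z ^+ 2) <= r^-1.
  by apply: bessel_integral_bounds => //; rewrite mulr_ge0 ?sqr_ge0// mulr_ge0.
by rewrite /sndr_tail mulr_ge0 ?expR_ge0//= mulrC ler_wpM2r// expR_ge0.
Qed.

Lemma measurable_sndr_tail (R : realType) (zeta r u : R) : 0 <= zeta -> 0 < r -> 0 <= u ->
  measurable_fun setT (sndr_tail zeta r u).
Proof.
move=> zeta0 r0 u0; apply: measurable_funM; last first.
  by apply: measurable_bessel => //; exact: mulr_ge0.
by apply: measurableT_comp => //; apply: measurable_funM.
Qed.

(** The scale [t] serves two purposes: t = 1 is the capacity integrand, and t = 1 / p its rescaling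
    in [capacity_term_foxH]. The bound on the tail gives a dominating exponential. *)
Lemma integrable_sndr_tail_scale (R : realType) (zeta r u t : R) :
  0 < zeta -> 0 < r -> 0 < u -> 0 < t ->
  (@lebesgue_measure R).-integrable (`]0, +oo[ : set R)
    (EFin \o (fun z => (1 + t * z)^-1 * sndr_tail zeta r u (t * z))).
Proof.
move=> zeta0 r0 u0 t0.
have p0 : 0 < (r * zeta + u) * t by rewrite mulr_gt0// addr_gt0// mulr_gt0.
have ib : (@lebesgue_measure R).-integrable (`]0, +oo[ : set R)
    (EFin \o (fun z => r^-1 * expR (- ((r * zeta + u) * t) * z))).
  by apply: integrableZlR => //; exact: integrable_expRN.
apply: (le_integrableR _ _ ib) => //.
- apply: measurable_funM; last first.
    apply: measurable_funTS; apply: measurableT_comp => //.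
    by apply: measurable_sndr_tail => //; exact: ltW.
  apply: measurable_fun_halfline_continuous => z z0; apply: cvgV.
    by rewrite lt0r_neq0// addr_gt0// mulr_gt0.
  apply: cvgD; first exact: cvg_cst.
  by apply: cvgM; [exact: cvg_cst|exact: cvg_id].
- move=> z /=; rewrite in_itv/= andbT => z0.
  have tz0 : 0 < t * z by exact: mulr_gt0.
  have /andP[s0] := sndr_tail_bounds (t * z) (ltW zeta0) r0 (ltW u0).
  rewrite mulrA mulNr => s1.
  have s2 : 0 <= (1 + t * z)^-1 by rewrite invr_ge0 addr_ge0// ltW.
  rewrite (ger0_norm (mulr_ge0 s2 s0)).
  by rewrite (le_trans _ s1)// ler_piMl// invf_le1 ?addr_gt0// lerDl ltW.
Qed.

Lemma integrable_sndr_tail (R : realType) (zeta r u : R) : 0 < zeta -> 0 < r -> 0 < u ->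
  (@lebesgue_measure R).-integrable (`]0, +oo[ : set R)
    (EFin \o (fun z => (1 + z)^-1 * sndr_tail zeta r u z)).
Proof.
move=> zeta0 r0 u0; have := integrable_sndr_tail_scale zeta0 r0 u0 ltr01.
by congr (integrable _ _ (_ \o _)); apply/funext => z; rewrite mul1r.
Qed.

(** What the same pair of terms contributes to the mean of ln(1 + bound). *)
Definition capacity_term (R : realType) (zeta r u : R) : R :=
  \int[lebesgue_measure]_(z in `]0, +oo[) ((1 + z)^-1 * sndr_tail zeta r u z).

(** In the coefficient, 1 / p comes from z = w / p, 1 / r from rescaling the Bessel integral, and
    tau2 / 2 undoes the factor of the H-function. *)
Lemma capacity_term_foxH (R : realType) (zeta r u c1 c2 : R) :
  0 < zeta -> 0 < r -> 0 < u -> admissible_lines c1 c2 ->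
  let p := r * zeta + u in
  let tau2 := Num.sqrt (r * u * zeta) / p in
  (capacity_term zeta r u)%:C = (tau2 / (2 * r * p))%:C * foxH c1 c2 p^-1 tau2.
Proof.
move=> zeta0 r0 u0 adm p tau2.
have p0 : 0 < p by rewrite addr_gt0// mulr_gt0.
have s0 : 0 < Num.sqrt (r * u * zeta) by rewrite sqrtr_gt0 !mulr_gt0.
have t0 : 0 < tau2 by rewrite divr_gt0.
rewrite foxHE ?invr_gt0// -rmorphM; congr (_%:C).
set J := \int[_]_(_ in _) _.
have -> : tau2 / (2 * r * p) * (2 / tau2 * J) = p^-1 * (r^-1 * J).
  by field; rewrite !lt0r_neq0.
have mS := measurable_int _ (integrable_sndr_tail zeta0 r0 u0).
have S0 (z : R) : 0 < z -> 0 <= (1 + z)^-1 * sndr_tail zeta r u z.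
  move=> z0; have /andP[s0' _] := sndr_tail_bounds z (ltW zeta0) r0 (ltW u0).
  by rewrite mulr_ge0// invr_ge0 addr_ge0// ltW.
have -> : J = r * \int[lebesgue_measure]_(w in `]0, +oo[)
    ((1 + p^-1 * w)^-1 * sndr_tail zeta r u (p^-1 * w)).
  rewrite -RintegralZl//; last by apply: integrable_sndr_tail_scale => //; rewrite invr_gt0.
  apply: eq_Rintegral => w _.
  have q0 : 0 <= u * zeta * (p^-1 * w) ^+ 2.
    by apply: mulr_ge0; [rewrite mulr_ge0// ltW|exact: sqr_ge0].
  rewrite /sndr_tail (bessel_integral_scale r0 q0).
  have -> : - (r * zeta + u) * (p^-1 * w) = - w.
    by move: p0; rewrite /p => p0'; field; rewrite lt0r_neq0.
  have -> : r * (u * zeta * (p^-1 * w) ^+ 2) = (tau2 * w) ^+ 2.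
    rewrite /tau2 !exprMn sqr_sqrtr; last by rewrite !mulr_ge0// ltW.
    ring.
  by set q := (1 + _)^-1; field; rewrite lt0r_neq0.
rewrite mulKf ?lt0r_neq0// /capacity_term; apply: ge0_halfline_Rscale => //.
  by rewrite invr_gt0.
by apply/measurable_EFinP.
Qed.

Section ergodic_capacity_expsum.
Context (R : realType) (d : measure_display) (T : measurableType d) (P : probability T R).
Variables (X Y : {RV P >-> R}) (zeta : R) (I J : Type) (s : seq I) (t : seq J).
Variables (a r : I -> R) (b u : J -> R).
Hypotheses (zeta0 : 0 < zeta) (X0 : forall w, 0 <= X w) (Y0 : forall w, 0 <= Y w).
Hypotheses (r0 : forall i, 0 < r i) (u0 : forall j, 0 < u j).
Hypothesis XY : independent_rvs X Y.
Hypothesis Xf : has_density_on_nonneg X (fun x => \sum_(i <- s) a i * expR (- r i * x)).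
Hypothesis Yf : forall y, 0 <= y -> ccdf Y y = (\sum_(j <- t) b j * expR (- u j * y))%:E.

(** Pairs of terms under one index, so that a single linear combination is integrated. *)
Let st := [seq (i, j) | i <- s, j <- t].
Let c (k : I * J) := a k.1 * b k.2.

Lemma sndr_ub_tail_expsum (z : R) : 0 < z ->
  P [set w | z < sndr_ub zeta (X w) (Y w)] =
  (\sum_(k <- st) c k * sndr_tail zeta (r k.1) (u k.2) z)%:E.
Proof.
move=> z0.
have zz : 0 < zeta * z by exact: mulr_gt0.
rewrite (sndr_ub_tail zeta0 X0 Y0 z0 XY Xf); last first.
  apply: measurable_funTS; apply: measurable_sum => i.
  by apply: measurable_funM => //; apply: measurableT_comp => //; apply: measurable_funM.
pose e (k : I * J) (x : R) := expR (- r k.1 * x - u k.2 * (z * x / (x - zeta * z))).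
have eE k := sndr_tail_integral zeta0 (r0 k.1) (u0 k.2) z0.
(* The integrand is nonnegative, so its integrability follows from the finite value in [eE]. *)
have ie k : (@lebesgue_measure R).-integrable (`](zeta * z), +oo[ : set R) (EFin \o e k).
  apply/integrableP; split.
    apply/measurable_EFinP; apply: open_continuous_measurable_fun; first exact: interval_open.
    move=> x; rewrite inE/= in_itv/= andbT => zx.
    apply: continuous_comp; last exact: continuous_expR.
    apply: cvgB; apply: cvgM; try exact: cvg_cst; try exact: cvg_id.
    apply: cvgM; first by apply: cvgM; [exact: cvg_cst|exact: cvg_id].
    apply: cvgV; first by rewrite subr_eq0 gt_eqF.
    by apply: cvgB; [exact: cvg_id|exact: cvg_cst].
  under eq_integral do rewrite /= ger0_norm ?expR_ge0//.
  by rewrite eE ltry.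
transitivity (\int[lebesgue_measure]_(x in `](zeta * z)%R, +oo[)
    (\sum_(k <- st) c k * e k x)%:E)%E.
  apply: eq_integral => x; rewrite inE/= in_itv/= andbT => zx.
  rewrite Yf; last by rewrite divr_ge0 ?mulr_ge0// ?(ltW z0)// ?(ltW (lt_trans zz zx))// subr_ge0 ltW.
  rewrite -EFinM; congr (_%:E); rewrite /st big_allpairs/= mulrC big_distrl/=.
  apply: eq_bigr => i _; rewrite big_distrr/=; apply: eq_bigr => j _.
  by rewrite /c /e/= expRD -[- (u j * _)]mulNr; ring.
rewrite integral_lincomb//; congr (_%:E).
by apply: eq_bigr => k _; rewrite /Rintegral eE.
Qed.

Lemma integral_ln1p_sndr_ub :
  (\int[P]_w (ln (1 + sndr_ub zeta (X w) (Y w)))%:E =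
   (\sum_(i <- s) \sum_(j <- t) a i * b j * capacity_term zeta (r i) (u j))%R%:E)%E.
Proof.
rewrite integral_ln1p_tail; last 2 first.
- exact: measurable_sndr_ub.
- exact: sndr_ub_ge0.
transitivity (\int[lebesgue_measure]_(z in `]0%R, +oo[)
    (\sum_(k <- st) c k * ((1 + z)^-1 * sndr_tail zeta (r k.1) (u k.2) z))%:E)%E.
  apply: eq_integral => z; rewrite inE/= in_itv/= andbT => z0.
  rewrite sndr_ub_tail_expsum// -EFinM; congr (_%:E).
  by rewrite big_distrr/=; apply: eq_bigr => k _; ring.
rewrite integral_lincomb//; last by move=> k; exact: integrable_sndr_tail.
by rewrite /st big_allpairs.
Qed.

End ergodic_capacity_expsum.

(** * Positivity of the exponential rates *)

Section hop_coefficients.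
Variables (R : realType) (N k : nat) (g1 g2 : R).
Hypotheses (g1_gt0 : 0 < g1) (g2_gt0 : 0 < g2).

Lemma gbar_gt0 : 0 < gbar g1 g2.
Proof. by rewrite divr_gt0 ?mulr_gt0 ?addr_gt0. Qed.

Lemma convex_gt0 (rho x y : R) : 0 <= rho <= 1 -> 0 < x -> 0 < y ->
  0 < rho * x + (1 - rho) * y.
Proof.
move=> /andP[]; rewrite le_eqVlt => /predU1P[<- _ x0 y0|rho0 rho1 x0 y0].
  by rewrite mul0r add0r subr0 mul1r.
by rewrite ltr_wpDr ?mulr_gt0// mulr_ge0 ?subr_ge0 ?(ltW y0).
Qed.

Lemma rank_shift1_gt0 n : 0 < rank_shift R N k n + 1.
Proof. by rewrite ltr_wpDl. Qed.

Lemma coefR_gt0 rho n j : 0 <= rho <= 1 -> 0 < coefR N k g1 g2 rho n j.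
Proof.
move=> rho01; rewrite /coefR; case: ifP => // _.
have n0 := rank_shift1_gt0 n.
by rewrite divr_gt0 ?mulr_gt0// -mulrA convex_gt0 ?gbar_gt0 ?mulr_gt0.
Qed.

Lemma coefU_gt0 rho m i : 0 <= rho <= 1 -> 0 < coefU N k g1 g2 rho m i.
Proof.
move=> rho01; rewrite /coefU; case: ifP => [_|_]; first exact: divr_gt0.
have m0 := rank_shift1_gt0 m.
by rewrite divr_gt0 ?mulr_gt0// -mulrA convex_gt0 ?gbar_gt0 ?mulr_gt0.
Qed.

End hop_coefficients.

(** * The capacity in natural logarithms *)

Lemma ergodic_capacity_ln (R : realType) (d : measure_display) (T : measurableType d)
    (P : probability T R) (G : T -> R) : measurable_fun setT G -> (forall w, 0 <= G w) ->
  ergodic_capacity P G = ((2 * ln 2)^-1%:E * \int[P]_w (ln (1 + G w))%:E)%E.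
Proof.
move=> mG G0; have l2 : 0 < ln 2 :> R by rewrite ln_gt0// ltr1n.
rewrite /ergodic_capacity unlock.
under eq_integral do rewrite /log2 mulrC EFinM.
rewrite ge0_integralZl//.
- by rewrite muleA -EFinM invfM.
- by apply/measurable_EFinP; apply: measurableT_comp => //; exact: measurable_funD.
- by move=> w _; rewrite lee_fin ln_ge0// lerDl.
- by rewrite lee_fin invr_ge0 ltW.
Qed.

Lemma le_ergodic_capacity (R : realType) (d : measure_display) (T : measurableType d)
    (P : probability T R) (F G : T -> R) :
  measurable_fun setT F -> measurable_fun setT G -> (forall w, 0 <= F w) ->
  (forall w, F w <= G w) -> (ergodic_capacity P F <= ergodic_capacity P G)%E.
Proof.
move=> mF mG F0 FG; have G0 w : 0 <= G w by exact: le_trans (FG w).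
have l2 : 0 < ln 2 :> R by rewrite ln_gt0// ltr1n.
rewrite !ergodic_capacity_ln//; apply: lee_wpmul2l.
  by rewrite lee_fin invr_ge0 mulr_ge0// ltW.
apply: ge0_le_integral => //.
- by move=> w _; rewrite lee_fin ln_ge0// lerDl.
- by apply/measurable_EFinP; apply: measurableT_comp => //; exact: measurable_funD.
- by apply/measurable_EFinP; apply: measurableT_comp => //; exact: measurable_funD.
- by move=> w _; rewrite lee_fin ler_ln ?posrE ?lerD2l// ltr_pwDl.
Qed.

Unset Implicit Arguments.

Theorem mainTheorem8 (R : realType) (d : measure_display)
    (T : measurableType d) (P : probability T R) (X Y : {RV P >-> R})
    (N k : nat) (g1 g2 rho1 rho2 zeta : R)
    (k_ge1 : (1 <= k)%N) (k_leN : (k <= N)%N)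
    (g1_gt0 : 0 < g1) (g2_gt0 : 0 < g2)
    (rho1_01 : 0 <= rho1 <= 1) (rho2_01 : 0 <= rho2 <= 1)
    (zeta_ge1 : 1 <= zeta)
    (X_ge0 : forall w, 0 <= X w) (Y_ge0 : forall w, 0 <= Y w)
    (XY_indep : independent_rvs X Y)
    (X_pdf : has_density_on_nonneg X (first_hop_pdf N k g1 g2 rho1))
    (Y_cdf : forall x : R, 0 <= x ->
       cdf Y x = (second_hop_cdf N k g1 g2 rho2 x)%:E) :
  let C := ergodic_capacity P (fun w => sndr zeta (X w) (Y w)) in
  let Cub := ergodic_capacity P (fun w => sndr_ub zeta (X w) (Y w)) in
  [/\ forall w, sndr zeta (X w) (Y w) <= sndr_ub zeta (X w) (Y w),
      (C <= Cub)%E,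
      Cub \is a fin_num &
      forall c1 c2 : R, admissible_lines c1 c2 ->
      (fine Cub)%:C =
      (k%:R ^+ 2 * g1 * 'C(N, k)%:R ^+ 2 / (4 * ln 2))%:C *
      \sum_(0 <= m < k) \sum_(0 <= n < k)
      \sum_(1 <= i < 3) \sum_(1 <= j < 3)
        let Sm := coefS N k g1 g2 m in
        let Pn := coefP N k g1 g2 n in
        let Tmi := coefT N k g1 g2 m i in
        let Qnj := coefQ N k g1 g2 rho1 n j in
        let Umi := coefU N k g1 g2 rho2 m i in
        let Rnj := coefR N k g1 g2 rho1 n j in
        (Sm * Pn * Tmi * Qnj / (Umi + zeta * Rnj) ^+ 2 *
           Num.sqrt (Umi * zeta / Rnj))%:C *
        foxH c1 c2 (g1 / (Umi + zeta * Rnj))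
          (Num.sqrt (zeta * Umi * Rnj) / (Umi + zeta * Rnj))].

Proof.
move=> C Cub.
have zeta0 : 0 < zeta by exact: lt_le_trans zeta_ge1.
have l2 : 0 < ln 2 :> R by rewrite ln_gt0// ltr1n.
have mub := measurable_sndr_ub zeta0 X_ge0 Y_ge0.
have ub0 := sndr_ub_ge0 zeta0 X_ge0 Y_ge0.
have le_ub w : sndr zeta (X w) (Y w) <= sndr_ub zeta (X w) (Y w).
  by apply: sndr_le_ub => //; exact: ltW.
(* Both distributions become mixtures over the same list of index pairs, with the rates divided by
   [g1]. *)
pose s := [seq (n, j) | n <- index_iota 0 k, j <- index_iota 1 3].
pose a (p : nat * nat) := k%:R / g1 * 'C(N, k)%:R *
  (coefP N k g1 g2 p.1 * coefQ N k g1 g2 rho1 p.1 p.2).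
pose r (p : nat * nat) := coefR N k g1 g2 rho1 p.1 p.2 / g1.
pose b (q : nat * nat) := k%:R * 'C(N, k)%:R *
  (coefS N k g1 g2 q.1 * coefT N k g1 g2 q.1 q.2).
pose u (q : nat * nat) := coefU N k g1 g2 rho2 q.1 q.2 / g1.
have R0 n j := coefR_gt0 N k g1_gt0 g2_gt0 n j rho1_01.
have U0 m i := coefU_gt0 N k g1_gt0 g2_gt0 m i rho2_01.
have r0 p : 0 < r p by rewrite divr_gt0.
have u0 q : 0 < u q by rewrite divr_gt0.
have pdfE : first_hop_pdf N k g1 g2 rho1 = fun x => \sum_(p <- s) a p * expR (- r p * x).
  apply/funext => x; rewrite /first_hop_pdf /s big_allpairs big_distrr/=.
  apply: eq_bigr => n _; rewrite big_distrr/=; apply: eq_bigr => j _.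
  by rewrite mulrA; congr (_ * expR _); rewrite /r/=; ring.
have cdfE y : 0 <= y -> ccdf Y y = (\sum_(q <- s) b q * expR (- u q * y))%:E.
  move=> y0; rewrite ccdf_1_cdf Y_cdf// /second_hop_cdf -EFinB subKr; congr (_%:E).
  rewrite /s big_allpairs big_distrr/=.
  apply: eq_bigr => m _; rewrite big_distrr/=; apply: eq_bigr => i _.
  by rewrite mulrA; congr (_ * expR _); rewrite /u/=; ring.
rewrite pdfE in X_pdf.
have CubE : Cub = ((2 * ln 2)^-1 *
    \sum_(p <- s) \sum_(q <- s) a p * b q * capacity_term zeta (r p) (u q))%:E.
  rewrite /Cub ergodic_capacity_ln//.
  by rewrite (integral_ln1p_sndr_ub zeta0 X_ge0 Y_ge0 r0 u0 XY_indep X_pdf cdfE).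
split=> //; first exact: le_ergodic_capacity (measurable_sndr zeta0 X_ge0 Y_ge0) mub
    (sndr_ge0 zeta0 X_ge0 Y_ge0) le_ub.
  by rewrite CubE.
move=> c1 c2 adm; rewrite CubE /= /s big_allpairs.
under eq_bigr do under eq_bigr do rewrite big_allpairs.
(* The sums come in the order n, j, m, i and are brought to m, n, i, j. *)
under eq_bigr do rewrite exchange_big/=.
rewrite exchange_big/=; under eq_bigr do under eq_bigr do rewrite exchange_big/=.
rewrite big_distrr [RHS]big_distrr raddf_sum/=; apply: eq_bigr => m _.
rewrite big_distrr [RHS]big_distrr raddf_sum/=; apply: eq_bigr => n _.
rewrite big_distrr [RHS]big_distrr raddf_sum/=; apply: eq_bigr => i _.
rewrite big_distrr [RHS]big_distrr raddf_sum/=; apply: eq_bigr => j _.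
have {}r0 := r0 (n, j); have {}u0 := u0 (m, i).
rewrite mulrA rmorphM/= (capacity_term_foxH zeta0 r0 u0 adm) /a /b /r /u/=.
move: (R0 n j) (U0 m i).
set Rnj := coefR _ _ _ _ _ _ _; set Umi := coefU _ _ _ _ _ _ _ => {}R0 {}U0.
have V0 : 0 < Umi + zeta * Rnj by rewrite addr_gt0// mulr_gt0.
(* Both rates carry 1 / g1, so 1 / p is the required tau1, while [g1] cancels in tau2. *)
have pE : Rnj / g1 * zeta + Umi / g1 = (Umi + zeta * Rnj) / g1 by ring.
have sE : Num.sqrt (Rnj / g1 * (Umi / g1) * zeta) = Num.sqrt (zeta * Umi * Rnj) / g1.
  have -> : Rnj / g1 * (Umi / g1) * zeta = zeta * Umi * Rnj * g1^-1 ^+ 2 by ring.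
  by rewrite sqrtrM ?sqrtr_sqr ?gtr0_norm ?invr_gt0// !mulr_ge0// ltW.
(* Both radicals are expressed by the same square root, which [field] then treats as an atom. *)
have sE' : Num.sqrt (Umi * zeta / Rnj) = Num.sqrt (zeta * Umi * Rnj) / Rnj.
  have -> : Umi * zeta / Rnj = zeta * Umi * Rnj * Rnj^-1 ^+ 2.
    by field; rewrite lt0r_neq0.
  by rewrite sqrtrM ?sqrtr_sqr ?gtr0_norm ?invr_gt0// !mulr_ge0// ltW.
rewrite pE sE sE' invf_div.
have -> : Num.sqrt (zeta * Umi * Rnj) / g1 * (g1 / (Umi + zeta * Rnj)) =
    Num.sqrt (zeta * Umi * Rnj) / (Umi + zeta * Rnj).
  by field; rewrite !lt0r_neq0.
rewrite [LHS]mulrA [RHS]mulrA -!rmorphM; congr (_%:C * _).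
field; rewrite !lt0r_neq0//.
Qed.
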